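(* Every tree is a $2$-MSP graph.
   Context: All graphs are finite and simple. Polygons are simple polygons (closed planar regions without holes); angles equal to $\pi$ are not considered vertices. The direction of a line segment in the plane is the angle it makes with the $x$-axis. For an integer $k>1$, an allowed direction (with respect to $k$) is one in $\{ i\pi/k : 0\le i<k\}$. A $k$-lizard is a polygon all of whose sides have allowed directions with respect to $k$ (side lengths are arbitrary); so a $2$-lizard is a polygon with axis-parallel sides. A scale of a $k$-lizard $L$ is a maximal convex $k$-lizard contained in $L$: a convex $k$-lizard $S\subseteq L$ such that whenever $T$ is a convex $k$-lizard with $S\subseteq T\subseteq L$, $T=S$. A graph $G$ is a $k$-MSP graph if there exist a $k$-lizard $L$ and a bijection between the vertices of $G$ and the scales of $L$ such that two vertices of $G$ are adjacent if and only if the interiors of the corresponding scales intersect. *)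

(* Defs.v *)
From HB Require Import structures.
From mathcomp Require Import all_boot all_order all_algebra.
From mathcomp Require Import all_classical all_reals all_analysis.

Set Implicit Arguments.
Unset Strict Implicit.
Unset Printing Implicit Defensive.

Import Order.TTheory GRing.Theory Num.Theory.
Import numFieldNormedType.Exports.

Local Open Scope classical_set_scope.
Local Open Scope ring_scope.

Definition simple_graph (V : finType) (e : rel V) : Prop :=
  symmetric e /\ irreflexive e.

(* A duplicate-free closed e-walk with at most two vertices is empty, a loop
   (impossible in a simple graph) or an edge traversed back and forth; hence
   the bound 2 in the last clause. *)
Definition tree (V : finType) (e : rel V) : Prop :=
  [/\ simple_graph e,
      (0 < #|V|)%N,
      forall x y : V, connect e x y
    & forall c : seq V, ucycle e c -> (size c <= 2)%N].

Section Plane.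
Variable R : realType.

Notation plane := (R * R)%type.
Implicit Types (p q r : plane) (s : seq plane) (A P L S T : set plane).

Definition boundary A : set plane := closure A `\` interior A.

Definition has_direction p q (theta : R) : Prop :=
  exists2 l : R, l != 0 & q - p = (l * cos theta, l * sin theta).

Definition allowed_direction (k : nat) p q : Prop :=
  exists2 i : nat, (i < k)%N & has_direction p q (i%:R * pi / k%:R).

Definition collinear p q r : Prop :=
  (q.1 - p.1) * (r.2 - q.2) = (q.2 - p.2) * (r.1 - q.1).

(* Indices are cyclic: the side following the last vertex closes the chain. *)
Definition vertex s (i : nat) : plane := nth 0 s (i %% size s)%N.

Definition side_point s (i : nat) (t : R) : plane :=
  (1 - t) *: vertex s i + t *: vertex s i.+1.

Definition closed_chain s : set plane :=
  [set x | exists i : nat, exists t : R,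
     [/\ (i < size s)%N, 0 <= t, t <= 1 & x = side_point s i t]].

(* Injectivity of the piecewise affine parametrization of the closed chain by
   a circle; the parameter t = 1 of a side is t = 0 of the next one, which is
   why it is left out. In particular the sides are nondegenerate. *)
Definition simple_chain s : Prop :=
  forall (i j : nat) (t u : R),
    (i < size s)%N -> (j < size s)%N ->
    0 <= t -> t < 1 -> 0 <= u -> u < 1 ->
    side_point s i t = side_point s j u -> i = j /\ t = u.

(* P is the simple polygon whose vertices are, in cyclic order, the entries of
   s: a bounded closed region (the closure of its connected interior) bounded
   by a simple closed polygonal curve. The second clause says that an angle
   equal to pi does not make a vertex. *)
Definition polygon_with_vertices s P : Prop :=
  [/\ (3 <= size s)%N,
      forall i : nat, (i < size s)%N ->
        ~ collinear (vertex s i) (vertex s i.+1) (vertex s i.+2)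
    & simple_chain s] /\
  [/\ compact P,
      connected (interior P),
      P = closure (interior P)
    & boundary P = closed_chain s].

Definition lizard (k : nat) P : Prop :=
  exists2 s : seq plane, polygon_with_vertices s P &
    forall i : nat, (i < size s)%N ->
      allowed_direction k (vertex s i) (vertex s i.+1).

Definition convex_lizard (k : nat) P : Prop :=
  lizard k P /\ @convex_set R (R * R)%type P.

Definition scale_of (k : nat) L S : Prop :=
  [/\ convex_lizard k S,
      S `<=` L
    & forall T, convex_lizard k T -> S `<=` T -> T `<=` L -> T = S].

(* The notion is meant for k > 1. Adjacency is only constrained between
   distinct vertices: the interior of a scale always meets itself. *)
Definition MSP_graph (k : nat) (V : finType) (e : rel V) : Prop :=
  exists2 L : set plane, lizard k L &
    exists2 f : V -> set plane,
      set_bij [set: V] [set S | scale_of k L S] f &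
      forall u v : V, u != v ->
        (e u v <-> interior (f u) `&` interior (f v) !=set0).

End Plane.

(* Main.v *)
(** Grow the tree leaf by leaf together with a polygon whose scales are the
    rectangles of the vertices present so far.  Each rectangle keeps a slot: a
    strip across it, disjoint from all other rectangles, that leaves the polygon
    at both of its ends.  To add a leaf w next to v, glue a small rectangle to
    the end of the slot of v: the only new maximal rectangle is the prolongation
    of the glued rectangle across that of v.  It meets no other one, it has a
    perpendicular slot in its protruding part, and v retains a smaller slot.
    Scales are rectangles because a convex polygon with axis-parallel sides
    contains the four corners of its bounding box. *)

Require Import Defs.
From mathcomp Require Import all_boot all_order all_algebra.
From mathcomp Require Import all_classical all_reals all_analysis.
From mathcomp Require Import ring lra zify.

Set Implicit Arguments.
Unset Strict Implicit.
Unset Printing Implicit Defensive.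

Import Order.TTheory GRing.Theory Num.Theory.
Import numFieldNormedType.Exports.

Local Open Scope classical_set_scope.
Local Open Scope ring_scope.

(** * Neighbourhoods, closures and boxes in the plane *)

Section PlaneTopology.
Variable R : realType.
Notation plane := (R * R)%type.
Implicit Types (z w : plane) (A : set plane).

(** Scales are never enumerated. It is enough that every rectangle inside the polygon lies in a
    recorded one and that no recorded rectangle lies in another. Slots serve both purposes.
    Prolonged by a margin beyond both ends, the strip meets the polygon only in its own rectangle,
    so a rectangle that enters the glued box is stopped at the far end of the slot. The prolonged
    strips also avoid each other and all foreign rectangles, so whatever is built inside one of them
    leaves the rest undisturbed. The main obstacle is that polygons are specified both topologically
    and by a cyclic list of vertices: gluing must preserve simplicity of the chain, connectedness of
    the interior, regularity and the boundary. Two symmetries reduce this to one situation. Rotating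
    the list makes the affected side the closing one, so that gluing appends four vertices;
    exchanging the coordinates turns an upper end into a right end. The orientation of the chain is
    not normalised, hence the recurring pairs of cases. *)

Lemma nbhs_planeP z A : nbhs z A <->
  exists2 e, 0 < e & forall x y,
    z.1 - e < x -> x < z.1 + e -> z.2 - e < y -> y < z.2 + e -> A (x, y).
Proof.
split=> [/nbhs_ballP [e /= e0 eA]|[e e0 eA]].
  exists e => // x y x1 x2 y1 y2; apply: eA; split => /=;
    by rewrite -ball_normE /= ltr_distlC; apply/andP; split; lra.
apply/nbhs_ballP; exists e => //= -[x y] [] /=.
rewrite -!ball_normE /= !ltr_distlC => /andP[x1 x2] /andP[y1 y2].
exact: eA.
Qed.

Lemma closure_planeP z A : closure A z <->
  forall e, 0 < e -> exists x y,
    [/\ z.1 - e < x, x < z.1 + e, z.2 - e < y, y < z.2 + e & A (x, y)].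
Proof.
split=> [cA e e0|cA B /nbhs_planeP[e e0 eB]].
  have /cA [[x y] [Axy]] : nbhs z [set w : plane | [/\ z.1 - e < w.1,
      w.1 < z.1 + e, z.2 - e < w.2 & w.2 < z.2 + e]].
    by apply/nbhs_planeP; exists e.
  by move=> -[/= ? ? ? ?]; exists x, y.
have [x [y [x1 x2 y1 y2 Axy]]] := cA e e0.
by exists (x, y); split=> //; exact: eB.
Qed.

Definition box (a b c d : R) : set plane :=
  [set z | [/\ a <= z.1, z.1 <= b, c <= z.2 & z.2 <= d]].

Definition obox (a b c d : R) : set plane :=
  [set z | [/\ a < z.1, z.1 < b, c < z.2 & z.2 < d]].

Variables a b c d : R.

Lemma interior_box : interior (box a b c d) = obox a b c d.
Proof.
apply/seteqP; split=> [[x y]|[x y] [/= x1 x2 y1 y2]].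
  move=> /nbhs_planeP[e e0 /= eb].
  have h : 0 < e / 2 by lra.
  have [/= ? _ ? _] : box a b c d (x - e / 2, y - e / 2) by apply: eb; lra.
  have [/= _ ? _ ?] : box a b c d (x + e / 2, y + e / 2) by apply: eb; lra.
  by split => /=; lra.
apply/nbhs_planeP => /=.
pose e := Num.min (Num.min (x - a) (b - x)) (Num.min (y - c) (d - y)).
have : e <= x - a /\ e <= b - x by rewrite /e !ge_min !lexx !orbT.
have : e <= y - c /\ e <= d - y by rewrite /e !ge_min !lexx !orbT.
have e0 : 0 < e by rewrite /e !lt_min !subr_gt0 x1 x2 y1 y2.
move=> [? ?] [? ?]; exists e => // ? ? ? ? ? ?; split => /=; lra.
Qed.

Lemma box_setX : box a b c d = `[a, b] `*` `[c, d].
Proof.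
apply/seteqP; split=> -[x y]; rewrite /= !in_itv /=.
  by move=> [/= -> -> -> ->].
by move=> [/andP[? ?] /andP[? ?]]; split.
Qed.

Lemma compact_box : compact (box a b c d).
Proof. by rewrite box_setX; apply: compact_setX; exact: segment_compact. Qed.

Lemma plane_hausdorff : hausdorff_space plane.
Proof. exact: norm_hausdorff. Qed.

Lemma closed_box : closed (box a b c d).
Proof. exact: compact_closed plane_hausdorff compact_box. Qed.

Lemma open_obox : open (obox a b c d).
Proof. by rewrite -interior_box; exact: open_interior. Qed.

Lemma closure_obox : a < b -> c < d -> closure (obox a b c d) = box a b c d.
Proof.
move=> ab cd; apply/seteqP; split.
  rewrite -interior_box; apply: subset_trans (closure_subset _) _.
    exact: interior_subset.
  by rewrite -(iffLR (closure_id _) closed_box).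
move=> [x y] [/= x1 x2 y1 y2]; apply/closure_planeP => /= e e0.
have close l u t : l < u -> l <= t -> t <= u ->
    exists t', [/\ t - e < t', t' < t + e, l < t' & t' < u].
  move=> lu lt tu.
  (* The coordinate is pushed away from the nearer end; [(u - l) / 4] keeps it from reaching the
     other end, [e / 2] keeps it close to [t]. *)
  pose m := Num.min (e / 2) ((u - l) / 4).
  have [m1 m2] : m <= e / 2 /\ m <= (u - l) / 4 by rewrite /m !ge_min !lexx !orbT.
  have m0 : 0 < m by rewrite /m lt_min; apply/andP; split; lra.
  have [h|h] := lerP t ((l + u) / 2).
    by exists (t + m); split; lra.
  by exists (t - m); split; lra.
have [x' [? ? ? ?]] := close _ _ _ ab x1 x2.
have [y' [? ? ? ?]] := close _ _ _ cd y1 y2.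
by exists x', y'.
Qed.

End PlaneTopology.

(** * Convex sets in coordinates, and their connectedness *)

Section Convexity.
Variable R : realType.
Notation plane := (R * R)%type.
Implicit Types (z w : plane) (A : set plane).

Lemma convex_setP A : @convex_set R plane A <->
  forall z w t, A z -> A w -> 0 <= t -> t <= 1 ->
    A (t * z.1 + (1 - t) * w.1, t * z.2 + (1 - t) * w.2).
Proof.
split=> [cA z w t Az Aw t0 t1|cA z w l].
  have [l lt] : exists l : {i01 R}, l%:num = t.
    by exists (Itv01 t0 t1).
  have := cA z w l; rewrite !inE => /(_ Az Aw).
  by rewrite -lt; apply.
rewrite !inE => Az Aw.
have [l0 l1] : 0 <= l%:num /\ l%:num <= 1 by split.
exact: cA Az Aw l0 l1.
Qed.

Lemma convex_box (a b c d : R) : @convex_set R plane (box a b c d).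
Proof.
apply/convex_setP => z w t [z1 z2 z3 z4] [w1 w2 w3 w4] t0 t1.
by split => /=; nra.
Qed.

Lemma continuous_pair (T : topologicalType) (f g : T -> R) :
  continuous f -> continuous g -> continuous (fun t => (f t, g t) : plane).
Proof. by move=> cf cg t; exact: cvg_pair (cf t) (cg t). Qed.

(** A convex set is the union of its segments to a fixed point, and these are connected sets with
    that point in common. *)
Lemma convex_connected A : @convex_set R plane A -> connected A.
Proof.
move=> /convex_setP cA.
have [->|/set0P[z0 Az0]] := eqVneq A set0; first exact: connected0.
pose seg w : set plane :=
  (fun t => (t * z0.1 + (1 - t) * w.1, t * z0.2 + (1 - t) * w.2)) @` `[0, 1].
have -> : A = \bigcup_(w in A) seg w.
  apply/seteqP; split=> [w Aw|z [w Aw [t /= + <-]]].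
    exists w => //; exists 0; first by rewrite /= in_itv /= lexx ler01.
    by rewrite !mul0r !add0r subr0 !mul1r; case: w {Aw}.
  by rewrite in_itv /= => /andP[t0 t1]; exact: cA.
apply: bigcup_connected.
  exists z0 => w Aw; exists 1; first by rewrite /= in_itv /= lexx ler01.
  by rewrite !mul1r subrr !mul0r !addr0; case: (z0).
move=> w Aw; apply: connected_continuous_connected.
  exact/connected_intervalP/interval_is_interval.
have lin (u v : R) : continuous (fun t : R => t * u + (1 - t) * v).
  move=> t; apply: cvgD; apply: cvgM; [exact: cvg_id|exact: cvg_cst| |].
    by apply: cvgB; [exact: cvg_cst|exact: cvg_id].
  exact: cvg_cst.
by apply: continuous_subspaceT; apply: continuous_pair; exact: lin.
Qed.

Lemma connected_obox (a b c d : R) : connected (obox a b c d).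
Proof.
apply/convex_connected/convex_setP => z w t [z1 z2 z3 z4] [w1 w2 w3 w4] t0 t1.
have [->|tn0] := eqVneq t 0; first by split => /=; lra.
have {tn0}t0 : 0 < t by rewrite lt_def tn0.
by split => /=; nra.
Qed.

End Convexity.

(** * Exchange of the coordinates *)

Section Transposition.
Variable R : realType.
Notation plane := (R * R)%type.
Implicit Types (z w : plane) (A : set plane) (s : seq plane).

(** This reflection reverses the orientation of a chain, which is harmless because no orientation
    enters the definition of a polygon. *)
Definition tp z : plane := (z.2, z.1).

Lemma tpK : involutive tp. Proof. by case. Qed.

Lemma image_tp A : tp @` A = tp @^-1` A.
Proof.
apply/seteqP; split=> [_ [z Az <-]|z Az]; first by rewrite /preimage/= tpK.
by exists (tp z); rewrite ?tpK.
Qed.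

Lemma continuous_tp : continuous tp.
Proof. by apply: continuous_pair => z; [exact: cvg_snd|exact: cvg_fst]. Qed.

Lemma compact_tp A : compact A -> compact (tp @^-1` A).
Proof.
move=> cA; rewrite -image_tp; apply: continuous_compact cA.
exact/continuous_subspaceT/continuous_tp.
Qed.

Lemma connected_tp A : connected A -> connected (tp @^-1` A).
Proof.
move=> cA; rewrite -image_tp; apply: connected_continuous_connected cA _.
exact/continuous_subspaceT/continuous_tp.
Qed.

Lemma interior_tp A : interior (tp @^-1` A) = tp @^-1` interior A.
Proof.
apply/seteqP; split=> z /nbhs_planeP[e e0 eA]; apply/nbhs_planeP; exists e => //.
  by move=> x y ? ? ? ?; exact: (eA y x).
by move=> x y ? ? ? ?; exact: (eA y x).
Qed.

Lemma closure_tp A : closure (tp @^-1` A) = tp @^-1` closure A.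
Proof.
apply/seteqP; split=> z /closure_planeP cA; apply/closure_planeP => e e0.
  by have [x [y [? ? ? ? ?]]] := cA e e0; exists y, x.
by have [x [y [? ? ? ? ?]]] := cA e e0; exists y, x.
Qed.

Lemma boundary_tp A : boundary (tp @^-1` A) = tp @^-1` boundary A.
Proof. by rewrite /boundary interior_tp closure_tp. Qed.

Lemma box_tp (a b c d : R) : tp @^-1` box a b c d = box c d a b.
Proof. by apply/seteqP; split=> -[x y] [/= ? ? ? ?]; split. Qed.

Lemma vertex_tp s i : vertex (map tp s) i = tp (vertex s i).
Proof.
rewrite /vertex size_map; case: s => [|p s]; first by rewrite !nth_nil.
by rewrite (nth_map 0) // ltn_mod.
Qed.

Lemma side_point_tp s i t : side_point (map tp s) i t = tp (side_point s i t).
Proof. by rewrite /side_point !vertex_tp. Qed.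

Lemma closed_chain_tp s : closed_chain (map tp s) = tp @^-1` closed_chain s.
Proof.
apply/seteqP; split=> z [i [t [si t0 t1 zE]]]; exists i, t; split => //.
- by rewrite size_map in si.
- by rewrite zE side_point_tp tpK.
- by rewrite size_map.
- by rewrite side_point_tp -zE tpK.
Qed.

Lemma polygon_with_vertices_tp s A :
  polygon_with_vertices s A -> polygon_with_vertices (map tp s) (tp @^-1` A).
Proof.
move=> [[s3 ncol smp] [cA iA rA bA]]; split; split.
- by rewrite size_map.
- move=> i; rewrite size_map => /ncol; rewrite !vertex_tp /collinear /=.
  by move=> h /esym h'; apply: h; lra.
- move=> i j t u; rewrite size_map !side_point_tp => si sj t0 t1 u0 u1.
  by move/(congr1 tp); rewrite !tpK; exact: smp.
- exact: compact_tp.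
- by rewrite interior_tp; exact: connected_tp.
- by rewrite interior_tp closure_tp -rA.
- by rewrite boundary_tp bA closed_chain_tp.
Qed.

End Transposition.

(** * Closed chains: rotation of the vertex list, sides, simplicity *)

Section Chains.
Variable R : realType.
Notation plane := (R * R)%type.
Implicit Types (p q z w : plane) (A : set plane) (s : seq plane).

Lemma allowed_direction2P p q :
  allowed_direction 2 p q <-> p <> q /\ (p.1 = q.1 \/ p.2 = q.2).
Proof.
case: p q => [p1 p2] [q1 q2]; split=> [[i i2 [l l0 /=]]|[/= pq h]].
  case: i i2 => [|[|//]] _.
    rewrite !mul0r cos0 sin0 mulr1 mulr0 => -[h1 h2].
    split; last by right; lra.
    by move=> [e1 e2]; move/eqP: l0; apply; lra.
  rewrite mul1r cos_pihalf sin_pihalf mulr1 mulr0 => -[h1 h2].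
  split; last by left; lra.
  by move=> [e1 e2]; move/eqP: l0; apply; lra.
case: h => h; rewrite h in pq *.
  exists 1%N => //; exists (q2 - p2).
    by rewrite subr_eq0; apply/eqP => e; apply: pq; rewrite e.
  by rewrite mul1r cos_pihalf sin_pihalf mulr1 mulr0; congr (_, _) => /=; lra.
exists 0%N => //; exists (q1 - p1).
  by rewrite subr_eq0; apply/eqP => e; apply: pq; rewrite e.
by rewrite !mul0r cos0 sin0 mulr1 mulr0; congr (_, _) => /=; lra.
Qed.

Lemma vertex_mod s i : vertex s (i %% size s) = vertex s i.
Proof. by rewrite /vertex modn_mod. Qed.

Lemma vertexS_mod s i : vertex s (i %% size s).+1 = vertex s i.+1.
Proof. by rewrite -vertex_mod -[RHS]vertex_mod -addn1 -[i.+1]addn1 modnDml. Qed.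

Lemma vertexSS_mod s i : vertex s (i %% size s).+2 = vertex s i.+2.
Proof. by rewrite -vertex_mod -[RHS]vertex_mod -addn2 -[i.+2]addn2 modnDml. Qed.

Lemma vertexDsize s i : vertex s (i + size s) = vertex s i.
Proof. by rewrite /vertex modnDr. Qed.

Lemma side_point_mod s i t : side_point s (i %% size s) t = side_point s i t.
Proof. by rewrite /side_point vertex_mod vertexS_mod. Qed.

Lemma vertex_rot1 s i : vertex (rot 1 s) i = vertex s i.+1.
Proof.
case: s => [|x s]; first by rewrite /vertex !nth_nil.
rewrite /vertex rot1_cons size_rcons nth_rcons /=.
have jn : (i %% (size s).+1 < (size s).+1)%N by rewrite ltn_mod.
rewrite -[i.+1]addn1 -modnDml addn1; move: jn.
set j := (i %% _)%N; rewrite ltnS leq_eqVlt => /orP[/eqP ->|jn].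
  by rewrite ltnn eqxx modnn.
by rewrite jn modn_small.
Qed.

Lemma side_point_rot1 s i t : side_point (rot 1 s) i t = side_point s i.+1 t.
Proof. by rewrite /side_point !vertex_rot1. Qed.

Lemma modS_inj n i j : (i < n)%N -> (j < n)%N ->
  (i.+1 %% n = j.+1 %% n)%N -> i = j.
Proof.
move=> ni nj /eqP; rewrite -addn1 -(addn1 j) eqn_modDr.
by rewrite !modn_small // => /eqP.
Qed.

Lemma polygon_with_vertices_rot1 s A :
  polygon_with_vertices s A -> polygon_with_vertices (rot 1 s) A.
Proof.
move=> [[s3 ncol smp] [cA iA rA bA]].
have s0 : (0 < size s)%N by exact: leq_trans s3.
split; split=> //.
- by rewrite size_rot.
- move=> i _; rewrite !vertex_rot1 -vertex_mod -vertexS_mod -vertexSS_mod.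
  by apply: ncol; rewrite ltn_mod.
- move=> i j t u; rewrite size_rot !side_point_rot1 => si sj t0 t1 u0 u1.
  rewrite -side_point_mod -[RHS]side_point_mod => /smp[]//; rewrite ?ltn_mod//.
  by move=> /(modS_inj si sj) -> ->.
- rewrite bA; apply/seteqP; split=> z [i [t [si t0 t1 ->]]].
    (* Side [j] of the rotated list is side [j.+1] of [s]; the predecessor of [i] is written with an
       addition because subtraction truncates at 0. *)
    exists ((i + (size s).-1) %% size s)%N, t; rewrite size_rot ltn_mod; split => //.
    rewrite side_point_rot1 /side_point vertexS_mod vertexSS_mod -addnS prednK //.
    by rewrite vertexDsize -(vertexS_mod s (i + _)) modnDr vertexS_mod.
  exists (i.+1 %% size s)%N, t; rewrite ltn_mod; split => //.
  by rewrite side_point_rot1 side_point_mod.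
Qed.

Definition side p q : set plane :=
  [set z | exists t, [/\ 0 <= t, t <= 1 &
    z = ((1 - t) * p.1 + t * q.1, (1 - t) * p.2 + t * q.2)]].

(** The end point is left out so that consecutive sides share no point and simplicity becomes
    pairwise disjointness. *)
Definition hside p q : set plane :=
  [set z | exists t, [/\ 0 <= t, t < 1 &
    z = ((1 - t) * p.1 + t * q.1, (1 - t) * p.2 + t * q.2)]].

Lemma hside_side p q : hside p q `<=` side p q.
Proof. by move=> z [t [t0 t1 ->]]; exists t; rewrite t0 ltW. Qed.

Lemma closed_chainP s z :
  closed_chain s z <-> exists2 i, (i < size s)%N & side (vertex s i) (vertex s i.+1) z.
Proof.
split=> [[i [t [si t0 t1 ->]]]|[i si [t [t0 t1 ->]]]]; last by exists i, t.
by exists i => //; exists t.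
Qed.

(** Injectivity within one side amounts to nondegeneracy; across sides it is disjointness, which for
    axis-parallel sides reduces to linear inequalities. *)
Lemma simple_chainP s : simple_chain s <->
  (forall i, (i < size s)%N -> vertex s i <> vertex s i.+1) /\
  (forall i j z, (i < j)%N -> (j < size s)%N ->
     hside (vertex s i) (vertex s i.+1) z ->
     hside (vertex s j) (vertex s j.+1) z -> False).
Proof.
split=> [smp|[nd dis] i j t u si sj t0 t1 u0 u1 e].
  split=> [i si vi|i j z ij sj [t [t0 t1 ->]] [u [u0 u1 e]]].
    have e : side_point s i 0 = side_point s i (1/2).
      by rewrite /side_point -vi -!scalerDl; congr (_ *: _); lra.
    by have [| | | |_] := smp i i 0 (1/2) si si _ _ _ _ e; lra.
  have [] := smp i j t u (ltn_trans ij sj) sj t0 t1 u0 u1 e.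
  by move=> ijE; rewrite ijE ltnn in ij.
have hi : hside (vertex s i) (vertex s i.+1) (side_point s i t) by exists t.
have hj : hside (vertex s j) (vertex s j.+1) (side_point s i t) by exists u.
have [ij|ij|ij] := ltngtP i j; [by case: (dis _ _ _ ij sj hi hj)|
  by case: (dis _ _ _ ij si hj hi)|].
split => //; subst j; apply/eqP; rewrite -subr_eq0.
have : (t - u) *: (vertex s i.+1 - vertex s i) == 0.
  rewrite scalerBl !scalerBr; apply/eqP; move: e; rewrite /side_point !scalerBl !scale1r.
  set p := vertex s i; set q := vertex s i.+1 => e.
  have lin r : r *: q - r *: p = (p - r *: p + r *: q) - p.
    by rewrite addrAC (addrAC p) subrr sub0r addrC.
  by rewrite !lin e subrr.
rewrite scaler_eq0 => /orP[//|]; rewrite [in X in X -> _]subr_eq0 => /eqP e'.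
by case: (nd i si (esym e')).
Qed.

Lemma lerpP (p q y : R) : (p <= y /\ y <= q) \/ (q <= y /\ y <= p) <->
  exists t, [/\ 0 <= t, t <= 1 & y = (1 - t) * p + t * q].
Proof.
split=> [|[t [t0 t1 ->]]]; last first.
  by case: (lerP p q) => pq; [left|right]; split; nra.
have [<-|/eqP pq h] := eqVneq p q.
  by move=> h; exists 0; split; lra.
have qp : q - p != 0 by rewrite subr_eq0 eq_sym; exact/eqP.
exists ((y - p) / (q - p)); have e : y - p = (y - p) / (q - p) * (q - p) by rewrite divfK.
move: e; set t := _ / _ => e.
case: h => -[h1 h2].
  have pq' : p < q by rewrite lt_def eq_sym (introN eqP pq) (le_trans h1).
  by split; nra.
have pq' : q < p by rewrite lt_def (introN eqP pq) (le_trans h1).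
by split; nra.
Qed.

Lemma sideV (b p q : R) z :
  side (b, p) (b, q) z <-> z.1 = b /\ (p <= z.2 /\ z.2 <= q \/ q <= z.2 /\ z.2 <= p).
Proof.
rewrite lerpP; split=> [[t [t0 t1 ->]]|[zb [t [t0 t1 zt]]]].
  by split; [rewrite /=; lra|exists t].
by exists t; split => //; case: z zb zt => x y /= -> ->; congr (_, _) => /=; lra.
Qed.

Lemma sideH (b p q : R) z :
  side (p, b) (q, b) z <-> z.2 = b /\ (p <= z.1 /\ z.1 <= q \/ q <= z.1 /\ z.1 <= p).
Proof.
rewrite lerpP; split=> [[t [t0 t1 ->]]|[zb [t [t0 t1 zt]]]].
  by split; [rewrite /=; lra|exists t].
by exists t; split => //; case: z zb zt => x y /= -> ->; congr (_, _) => /=; lra.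
Qed.

Lemma hlerpP (p q y : R) : p <> q -> (p <= y /\ y < q) \/ (q < y /\ y <= p) <->
  exists t, [/\ 0 <= t, t < 1 & y = (1 - t) * p + t * q].
Proof.
move=> pq; have pq' : p < q \/ q < p by case: (ltgtP p q) pq => //; [left|right].
split=> [h|[t [t0 t1 ->]]]; last first.
  by case: pq' => {}pq; [left|right]; split; nra.
have /lerpP[t [t0 t1 yE]] : (p <= y /\ y <= q) \/ (q <= y /\ y <= p).
  by case: h => -[? ?]; [left|right]; split; lra.
exists t; split => //; rewrite lt_def t1 andbT; apply/eqP => t1'.
by subst t; lra.
Qed.

Lemma hsideV (b p q : R) z : p <> q ->
  hside (b, p) (b, q) z <-> z.1 = b /\ (p <= z.2 /\ z.2 < q \/ q < z.2 /\ z.2 <= p).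
Proof.
move=> pq; rewrite hlerpP //; split=> [[t [t0 t1 ->]]|[zb [t [t0 t1 zt]]]].
  by split; [rewrite /=; lra|exists t].
by exists t; split => //; case: z zb zt => x y /= -> ->; congr (_, _) => /=; lra.
Qed.

Lemma hsideH (b p q : R) z : p <> q ->
  hside (p, b) (q, b) z <-> z.2 = b /\ (p <= z.1 /\ z.1 < q \/ q < z.1 /\ z.1 <= p).
Proof.
move=> pq; rewrite hlerpP //; split=> [[t [t0 t1 ->]]|[zb [t [t0 t1 zt]]]].
  by split; [rewrite /=; lra|exists t].
by exists t; split => //; case: z zb zt => x y /= -> ->; congr (_, _) => /=; lra.
Qed.

(** The index is unbounded because [vertex] reads it cyclically; rotating the list is then a mere
    shift of the index. *)
Definition has_side s (p q : plane) : Prop :=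
  exists2 i, vertex s i = p & vertex s i.+1 = q.

Lemma has_side_rot1 s p q : (0 < size s)%N -> has_side s p q -> has_side (rot 1 s) p q.
Proof.
move=> s0 [i <- <-]; exists (i + (size s).-1)%N; rewrite vertex_rot1.
  by rewrite -addnS prednK // vertexDsize.
by rewrite -addnS prednK // -addSn vertexDsize.
Qed.

Lemma has_side_tp s p q : has_side s p q -> has_side (map (@tp R) s) (tp p) (tp q).
Proof. by move=> [i <- <-]; exists i; rewrite vertex_tp. Qed.

Definition axis_parallel s : Prop :=
  forall i, allowed_direction 2 (vertex s i) (vertex s i.+1).

Lemma axis_parallel_lizard s : (0 < size s)%N ->
  (forall i, (i < size s)%N -> allowed_direction 2 (vertex s i) (vertex s i.+1)) ->
  axis_parallel s.
Proof.
by move=> s0 h i; rewrite -vertex_mod -vertexS_mod; apply: h; rewrite ltn_mod.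
Qed.

Lemma axis_parallel_tp s : axis_parallel s -> axis_parallel (map (@tp R) s).
Proof.
move=> h i; have /allowed_direction2P[n d] := h i.
apply/allowed_direction2P; rewrite !vertex_tp /=; split; last by case: d; auto.
by move=> e; apply: n; rewrite -[LHS]tpK e tpK.
Qed.

End Chains.

(** * Boxes as convex lizards; boundary points of polygons *)

Section Boxes.
Variable R : realType.
Notation plane := (R * R)%type.
Implicit Types (p q z w : plane) (A P : set plane) (s : seq plane).

Definition corners (a b c d : R) : seq plane := [:: (a, c); (b, c); (b, d); (a, d)].

Lemma box_polygon (a b c d : R) : a < b -> c < d ->
  polygon_with_vertices (corners a b c d) (box a b c d).
Proof.
move=> ab cd.
have [nba ndc] : b <> a /\ d <> c by lra.
have [nab ncd] : a <> b /\ c <> d by lra.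
split; split=> //.
- by move=> [|[|[|[|//]]]] _; rewrite /collinear /vertex /= => h; nra.
- apply/simple_chainP; split.
    by move=> [|[|[|[|//]]]] _; rewrite /vertex /= => -[]; lra.
  move=> [|[|[|i]]] [|[|[|[|j]]]] z //= _ _; rewrite /vertex /= ?hsideH ?hsideV //; lra.
- exact: compact_box.
- by rewrite interior_box; exact: connected_obox.
- by rewrite interior_box closure_obox.
- rewrite /boundary interior_box -(iffLR (closure_id _) (@closed_box _ a b c d)).
  apply/seteqP; split=> [z [[z1 z2 z3 z4] nz]|z /closed_chainP[i i4]].
    apply/closed_chainP.
    have [e|n1] := eqVneq z.1 a.
      by exists 3%N => //; apply/sideV; split => //; right.
    have [e|n2] := eqVneq z.1 b.
      by exists 1%N => //; apply/sideV; split => //; left.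
    have [e|n3] := eqVneq z.2 c.
      by exists 0%N => //; apply/sideH; split => //; left.
    have [e|n4] := eqVneq z.2 d.
      by exists 2%N => //; apply/sideH; split => //; right.
    case: nz; split; rewrite lt_def; apply/andP; split=> //; by rewrite eq_sym.
  move: i i4 => [|[|[|[|//]]]] _; rewrite /vertex /= => h.
  all: first [move/sideH: h | move/sideV: h] => -[h1 h2]; split.
  all: try by split; lra.
  all: by case=> *; lra.
Qed.

Lemma box_convex_lizard (a b c d : R) : a < b -> c < d ->
  convex_lizard 2 (box a b c d).
Proof.
move=> ab cd; split; last exact: convex_box.
exists (corners a b c d); first exact: box_polygon.
move=> [|[|[|[|//]]]] _; apply/allowed_direction2P; rewrite /vertex /=; split;
  by [move=> []; lra|tauto].
Qed.

Lemma nbhs_affine_gt0 z (f : plane -> R) (u v w : R) :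
  (forall x y, f (x, y) = u * x + v * y + w) -> 0 < f z ->
  nbhs z [set z | 0 < f z].
Proof.
move=> fE; case: z => x0 y0; rewrite fE => f0; apply/nbhs_planeP => /=.
have u0 : 0 <= `|u| by []. have v0 : 0 <= `|v| by [].
(* Within the radius [f z / k] the function drops by at most [|u| + |v|] times the radius, less than
   [f z]; the summand 1 keeps [k] positive. *)
pose k := `|u| + `|v| + 1; have k0 : 0 < k by rewrite /k; lra.
exists ((u * x0 + v * y0 + w) / k); first exact: divr_gt0.
set e := _ / k => x y x1 x2 y1 y2; rewrite fE.
have ek : e * k = u * x0 + v * y0 + w by rewrite /e divfK // gt_eqF.
have e0 : 0 < e by exact: divr_gt0.
have hx : - (`|u| * e) <= u * (x - x0).
  have := ler_norm (- (u * (x - x0))); rewrite normrN normrM.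
  have : `|x - x0| <= e by rewrite ler_distlC; apply/andP; split; lra.
  by move=> h1 h2; nra.
have hy : - (`|v| * e) <= v * (y - y0).
  have := ler_norm (- (v * (y - y0))); rewrite normrN normrM.
  have : `|y - y0| <= e by rewrite ler_distlC; apply/andP; split; lra.
  by move=> h1 h2; nra.
rewrite /k in ek; nra.
Qed.

(* The triangle with vertices w, k and z covers both sides of the beginning of
   the side from w to h. *)
Lemma side_enters_interior P w h k z :
  @convex_set R plane P -> P w -> P k -> P z ->
  k.1 = w.1 -> h.2 = w.2 ->
  0 < (h.1 - w.1) * (z.1 - w.1) -> (k.2 - w.2) * (z.2 - w.2) < 0 ->
  exists2 p, side w h p & nbhs p P.
Proof.
move: w h k z => [w1 w2] [h1 h2] [k1 k2] [z1 z2] /= /convex_setP cP Pw Pk Pz.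
move=> kw hw hz kz; subst k1 h2.
have z0 : z1 - w1 != 0 by apply/eqP => e; move: hz; rewrite e; lra.
have k0 : k2 - w2 != 0 by apply/eqP => e; move: kz; rewrite e; lra.
pose r := (h1 - w1) / (z1 - w1).
have rE : r * (z1 - w1) = h1 - w1 by rewrite /r divfK.
have r0 : 0 < r.
  by move: hz; rewrite -rE -mulrA -expr2 pmulr_lgt0 // exprn_even_gt0.
pose g := (z2 - w2) / (k2 - w2).
have gE : g * (k2 - w2) = z2 - w2 by rewrite /g divfK.
have g0 : g < 0.
  by move: kz; rewrite -gE mulrCA -expr2 pmulr_llt0 // exprn_even_gt0.
(* [lam] and [mu] are affine coordinates with origin [w] and axes towards [z] and [k]; the open
   triangle is where [lam], [mu] and [1 - lam - mu] are positive. *)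
pose lam (p : plane) := (p.1 - w1) / (z1 - w1).
pose mu (p : plane) := (p.2 - w2) / (k2 - w2) - g * lam p.
(* At parameter [t] of the side the coordinates are [t * r] and [- g * (t * r)]; this choice makes
   their sum less than 1/2. *)
pose t := 1 / (1 + 2 * r * (1 - g)).
have rg : 0 < r * (1 - g) by rewrite mulr_gt0 //; lra.
have D0 : 0 < 1 + 2 * r * (1 - g) by lra.
have tE : t * (1 + 2 * r * (1 - g)) = 1 by rewrite /t div1r mulVf // gt_eqF.
have t0 : 0 < t by rewrite /t div1r invr_gt0.
have t1 : t <= 1 by have := mulr_gt0 t0 rg; lra.
pose p := (w1 + t * (h1 - w1), w2).
have lp : lam p = t * r by rewrite /lam /p /= /r; field.
have mp : mu p = - g * (t * r) by rewrite /mu lp /p /=; field.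
exists p.
  by exists t; split => //; [lra|rewrite /p /=; congr (_, _); lra].
have n1 : nbhs p [set q | 0 < lam q].
  apply: (@nbhs_affine_gt0 _ _ (z1 - w1)^-1 0 (- w1 / (z1 - w1))).
    by move=> x y; rewrite /lam /=; field.
  by rewrite lp mulr_gt0.
have n2 : nbhs p [set q | 0 < mu q].
  apply: (@nbhs_affine_gt0 _ _ (- g / (z1 - w1)) (k2 - w2)^-1
    (- w2 / (k2 - w2) + g * w1 / (z1 - w1))).
    by move=> x y; rewrite /mu /lam /=; field; rewrite z0 k0.
  by rewrite mp; nra.
have n3 : nbhs p [set q | 0 < 1 - lam q - mu q].
  apply: (@nbhs_affine_gt0 _ _ (- (1 - g) / (z1 - w1)) (- (k2 - w2)^-1)
    (1 + w2 / (k2 - w2) + (1 - g) * w1 / (z1 - w1))).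
    by move=> x y; rewrite /mu /lam /=; field; rewrite z0 k0.
  by rewrite mp lp; nra.
apply: filterS (filterI n1 (filterI n2 n3)) => -[x y] /= [l0 [m0 lm]].
have xE : x = w1 + lam (x, y) * (z1 - w1) by rewrite /lam /=; field.
have yE : y = w2 + lam (x, y) * (z2 - w2) + mu (x, y) * (k2 - w2).
  by rewrite -gE /mu /lam /=; field; rewrite z0 k0.
move: l0 m0 lm xE yE; set l := lam _; set m := mu _ => l0 m0 lm xE yE.
(* The point is reached by two convex combinations: one of [k] and [w], then one of the result with
   [z]. *)
pose t' := m / (1 - l).
have l1 : 1 - l != 0 by apply/eqP; lra.
have t'E : t' * (1 - l) = m by rewrite /t' divfK.
have [t'0 t'1] : 0 <= t' /\ t' <= 1 by split; nra.
have := cP _ _ l Pz (cP _ _ t' Pk Pw t'0 t'1) _ _ => /= h.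
have -> : (x, y) = (l * z1 + (1 - l) * (t' * w1 + (1 - t') * w1),
     l * z2 + (1 - l) * (t' * k2 + (1 - t') * w2)).
  by rewrite xE yE -t'E; congr (_, _); ring.
by apply: h; lra.
Qed.

Lemma polygon_boundary s P z :
  polygon_with_vertices s P -> closed_chain s z -> P z /\ ~ nbhs z P.
Proof.
move=> [_ [cP _ _ bP]]; rewrite -bP => -[cz nz]; split=> //; move: cz.
by rewrite -(iffLR (closure_id _) (compact_closed (@plane_hausdorff R) cP)).
Qed.

Lemma polygon_vertex s P i : polygon_with_vertices s P -> P (vertex s i).
Proof.
move=> sP; have [[s3 _ _] _] := sP.
suff : closed_chain s (vertex s i) by case/(polygon_boundary sP).
exists (i %% size s)%N, 0; rewrite side_point_mod ltn_mod (leq_trans _ s3) //; split => //.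
by rewrite /side_point subr0 scale1r scale0r addr0.
Qed.

Lemma closed_chain_side s i z : (0 < size s)%N ->
  side (vertex s i) (vertex s i.+1) z -> closed_chain s z.
Proof.
move=> s0 zi; apply/closed_chainP; exists (i %% size s)%N; first by rewrite ltn_mod.
by rewrite vertex_mod vertexS_mod.
Qed.

End Boxes.

(** * Convex polygons with axis-parallel sides are boxes *)

Section ConvexLizards.
Variable R : realType.
Notation plane := (R * R)%type.
Implicit Types (p q z w : plane) (A P : set plane) (s : seq plane).

Lemma polygon_interior s P : polygon_with_vertices s P -> exists z, nbhs z P.
Proof.
move=> sP; have P0 := polygon_vertex 0 sP.
case: sP => _ [_ _ rP _]; rewrite rP in P0.
have /closure_planeP cl := P0.
have [x [y [_ _ _ _ xy]]] := cl _ ltr01.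
by exists (x, y).
Qed.

(* The maximum over P of sx x + sy y is attained at a vertex w.  If P went
   beyond w in one coordinate, the side of w in the direction of the other one
   would enter the interior of P. *)
Lemma polygon_corner s P sx sy :
  polygon_with_vertices s P -> @convex_set R plane P ->
  (forall i, (i < size s)%N -> allowed_direction 2 (vertex s i) (vertex s i.+1)) ->
  (sx = 1 \/ sx = -1) -> (sy = 1 \/ sy = -1) ->
  exists2 w, P w & forall z, P z -> sx * z.1 <= sx * w.1 /\ sy * z.2 <= sy * w.2.
Proof.
move=> sP cP dP sx1 sy1; pose f z := sx * z.1 + sy * z.2.
have [[s3 ncol _] [kP _ _ bP]] := sP.
have s0 : (0 < size s)%N by exact: leq_trans s3.
have chP := polygon_boundary sP.
have [z0 Pz0 z0max] : exists2 z, P z & forall z', P z' -> f z' <= f z.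
  have [||z] := @compact_EVT_max _ _ f P _ kP.
  - by exists (vertex s 0); exact: polygon_vertex sP.
  - apply: continuous_subspaceT => z; apply: cvgD; apply: cvgM.
    + exact: cvg_cst. + exact: cvg_fst. + exact: cvg_cst. + exact: cvg_snd.
  - by rewrite inE => Pz zmax; exists z => // z' Pz'; apply: zmax; rewrite inE.
(* From an interior point a small diagonal step would increase [f]. *)
have /closed_chainP[i si [t [t0 t1 z0E]]] : closed_chain s z0.
  rewrite -bP; split; first exact: subset_closure.
  move=> /nbhs_planeP[e e0 eP].
  have Pe : P (z0.1 + sx * (e / 2), z0.2 + sy * (e / 2)).
    by apply: eP; case: sx1 => e1; case: sy1 => e2; rewrite ?e1 ?e2; lra.
  by have := z0max _ Pe; rewrite /f /=; case: sx1 => ->; case: sy1 => ->; lra.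
have Pv k : P (vertex s k) by exact: polygon_vertex sP.
(* On a side the linear function [f] is largest at one of the ends. The index has the form [j.+1] to
   give access to the predecessor [j]. *)
have [j wmax] : exists j, forall z, P z -> f z <= f (vertex s j.+1).
  have [h|h] := lerP (f (vertex s i)) (f (vertex s i.+1)).
    exists i => z /z0max /le_trans; apply.
    by rewrite z0E /f /=; rewrite /f in h; nra.
  exists (i + (size s).-1)%N => z /z0max /le_trans; apply.
  rewrite -addnS prednK // vertexDsize.
  by rewrite z0E /f /=; rewrite /f in h; nra.
have dj k : vertex s k <> vertex s k.+1 /\
    ((vertex s k).1 = (vertex s k.+1).1 \/ (vertex s k).2 = (vertex s k.+1).2).
  apply/allowed_direction2P; rewrite -vertex_mod -vertexS_mod; apply: dP.
  by rewrite ltn_mod.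
have nc : ~ collinear (vertex s j) (vertex s j.+1) (vertex s j.+2).
  rewrite -vertex_mod -vertexS_mod -vertexSS_mod.
  by apply: ncol; rewrite ltn_mod.
set w := vertex s j.+1 in wmax dj nc.
(* [h] and [k] are the two neighbours of [w]; were both sides at [w] horizontal or both vertical,
   the three vertices would be collinear. *)
have [h [k [Ph Pk [hw2 kw1] nhw [nkw hch kch]]]] : exists h k, 
    [/\ P h, P k, h.2 = w.2 /\ k.1 = w.1, h <> w &
    [/\ k <> w, side w h `<=` closed_chain s & side w k `<=` closed_chain s]].
  have [nu du] := dj j; have [nv dv] := dj j.+1.
  have su : side w (vertex s j) `<=` closed_chain s.
    move=> z [t' [t'0 t'1 zE]]; apply: (@closed_chain_side _ _ j) => //.
    by exists (1 - t'); split; [lra|lra|rewrite zE; congr (_, _) => /=; rewrite -/w; lra].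
  have sv : side w (vertex s j.+2) `<=` closed_chain s.
    by move=> z; exact: closed_chain_side.
  case: du => du; case: dv => dv.
  - by case: nc; rewrite /collinear -/w du -dv; lra.
  - by exists (vertex s j.+2), (vertex s j); split; rewrite ?dv; try split; auto.
  - by exists (vertex s j), (vertex s j.+2); split; rewrite ?dv; try split; auto.
  - by case: nc; rewrite /collinear -/w du -dv; lra.
have hw1 : sx * h.1 < sx * w.1.
  rewrite lt_def; apply/andP; split; last by have := wmax _ Ph; rewrite /f hw2; lra.
  apply/eqP => e; apply: nhw; case: h w hw2 e {wmax dj nc kw1 nkw hch kch Ph} => h1 h2 [w1 w2] /= ->.
  by case: sx1 => -> e; congr (_, _); lra.
have kw2 : sy * k.2 < sy * w.2.
  rewrite lt_def; apply/andP; split; last by have := wmax _ Pk; rewrite /f kw1; lra.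
  apply/eqP => e; apply: nkw; case: k w kw1 e {wmax dj nc hw1 nhw hw2 hch kch Pk} => k1 k2 [w1 w2] /= ->.
  by case: sy1 => -> e; congr (_, _); lra.
exists w; first exact: Pv.
move=> z Pz; have fz := wmax _ Pz; rewrite /f in fz; split.
  case: (lerP (sx * z.1) (sx * w.1)) => // zw.
  (* After exchanging the coordinates, the vertical side towards [k] takes the place of the
     horizontal side towards [h]. *)
  have [p wp np] : exists2 p, side (tp w) (tp k) p & nbhs p (@tp R @^-1` P).
    apply: (@side_enters_interior _ _ _ _ (tp h) (tp z)) => //=; rewrite ?tpK //.
    - apply/convex_setP => z1 z2 r Pz1 Pz2 r0 r1.
      exact: ((iffLR (convex_setP _) cP) (tp z1) (tp z2)).
    - exact: Pv.
    - by case: sy1 => e; rewrite e in kw2 fz; nra.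
    - by case: sx1 => e; rewrite e in hw1 zw; nra.
  have : nbhs (tp p) P by have := np; rewrite -/(interior _ p) interior_tp.
  move=> np'; exfalso; apply: (proj2 (chP (tp p) _)) np'; apply: kch.
  by case: wp => r [r0 r1 ->]; exists r.
case: (lerP (sy * z.2) (sy * w.2)) => // zw.
have [p wp np] : exists2 p, side w h p & nbhs p P.
  apply: (@side_enters_interior _ _ _ _ k z) => //=.
  - exact: Pv.
  - by case: sx1 => e; rewrite e in hw1 fz; case: sy1 => e'; rewrite e' in fz zw; nra.
  - by case: sy1 => e; rewrite e in kw2 zw; nra.
by case: (proj2 (chP p (hch _ wp))).
Qed.

Lemma convex_lizard_box P : convex_lizard 2 P ->
  exists a b c d, [/\ a < b, c < d & P = box a b c d].
Proof.
move=> [[s sP dP] cP].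
have corner sx sy := polygon_corner sP cP dP (sx := sx) (sy := sy).
have [p Pp pP] := corner (-1) (-1) (or_intror erefl) (or_intror erefl).
have [q Pq qP] := corner 1 1 (or_introl erefl) (or_introl erefl).
have [u Pu uP] := corner (-1) 1 (or_intror erefl) (or_introl erefl).
have [v Pv vP] := corner 1 (-1) (or_introl erefl) (or_intror erefl).
have PE : P `<=` box p.1 q.1 p.2 q.2.
  by move=> z Pz; have [? ?] := pP _ Pz; have [? ?] := qP _ Pz; split; lra.
have [[x y] /nbhs_planeP[e e0 eP]] := polygon_interior sP.
rewrite /= in eP.
have [/= ? _ ? _] : box p.1 q.1 p.2 q.2 (x - e / 2, y - e / 2) by apply/PE/eP; lra.
have [/= _ ? _ ?] : box p.1 q.1 p.2 q.2 (x + e / 2, y + e / 2) by apply/PE/eP; lra.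
have [pq1 pq2] : p.1 < q.1 /\ p.2 < q.2 by lra.
exists p.1, q.1, p.2, q.2; split => //.
apply/seteqP; split => // -[x' y'] [x1 x2 y1 y2]; rewrite /= in x1 x2 y1 y2.
have /lerpP[t [t0 t1 xE]] : q.1 <= x' /\ x' <= p.1 \/ p.1 <= x' /\ x' <= q.1 by right.
have /lerpP[r [r0 r1 yE]] : q.2 <= y' /\ y' <= p.2 \/ p.2 <= y' /\ y' <= q.2 by right.
have /convex_setP cP' := cP.
have up : u.1 = p.1 /\ u.2 = q.2.
  have [? ?] := PE _ Pu; have [? ?] := uP _ Pp; have [? ?] := uP _ Pq; lra.
have vp : v.1 = q.1 /\ v.2 = p.2.
  have [? ?] := PE _ Pv; have [? ?] := vP _ Pp; have [? ?] := vP _ Pq; lra.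
(* [b] and [tt] put the points of abscissa [x'] on the bottom and top sides into [P]; the given
   point lies between them. *)
have b := cP' _ _ _ Pp Pv t0 t1.
have tt := cP' _ _ _ Pu Pq t0 t1.
have := cP' _ _ _ b tt r0 r1.
move: up vp => [-> ->] [-> ->] /=.
congr (P (_, _)); lra.
Qed.

End ConvexLizards.

(** * Gluing a box to the closing side of a polygon *)

Section Attach.
Variable R : realType.
Notation plane := (R * R)%type.
Implicit Types (z : plane) (P : set plane) (s : seq plane).

Lemma side_hside (u v z : plane) : side u v z -> hside u v z \/ z = v.
Proof.
move=> [t [t0]]; rewrite le_eqVlt => /orP[/eqP -> zE|t1 zE]; last by left; exists t.
by right; rewrite zE; case: v {zE} => v1 v2; congr (_, _) => /=; lra.
Qed.

Lemma vertex_cat_l s s' i : (i < size s)%N -> vertex (s ++ s') i = vertex s i.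
Proof.
move=> si; rewrite /vertex size_cat !modn_small //; first by rewrite nth_cat si.
exact: leq_trans si (leq_addr _ _).
Qed.

Lemma vertex_cat_r s s' i : (i < size s')%N ->
  vertex (s ++ s') (size s + i) = vertex s' i.
Proof.
move=> si; rewrite /vertex size_cat !modn_small ?ltn_add2l //.
by rewrite nth_cat ltnNge leq_addr /= addKn.
Qed.

Variables (s : seq plane) (P : set plane).
Variables a b b' lo hi p q t1 t2 e0 : R.

(** The list [s] ends with [(b, p)] and begins with [(b, q)], so the four new vertices make a detour
    inside its closing side. *)
Definition attach : seq plane := s ++ [:: (b, t1); (b', t1); (b', t2); (b, t2)].

Hypothesis sP : polygon_with_vertices s P.
Hypothesis last_s : vertex s (size s).-1 = (b, p).
Hypothesis head_s : vertex s 0 = (b, q).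
(** The closing side may run upwards or downwards; [lo] and [hi] name the heights [t1] and [t2] in
    increasing order. *)
Hypothesis order_t : [/\ p < t1, t1 < t2, t2 < q, lo = t1 & hi = t2] \/
  [/\ q < t2, t2 < t1, t1 < p, lo = t2 & hi = t1].
Hypothesis ab : a < b.
Hypothesis bb' : b < b'.
Hypothesis aP : box a b lo hi `<=` P.
Hypothesis e0gt0 : 0 < e0.
(** The clearance [e0] around the glued box provides points outside the union arbitrarily close to
    its top, bottom and right sides. *)
Hypothesis freeP : forall x y, b < x -> x <= b' + e0 ->
  lo - e0 <= y -> y <= hi + e0 -> ~ P (x, y).

Local Notation m := (size s).-1.

Lemma m_gt1 : (1 < m)%N.
Proof. by case: sP => -[]; case: (size s). Qed.

Lemma size_m : size s = m.+1.
Proof. by case: sP => -[]; case: (size s). Qed.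

Lemma size_attach : size attach = (m + 5)%N.
Proof. by rewrite /attach size_cat /= size_m addSn -addnS. Qed.

Lemma vertex_attach i : (i <= m)%N -> vertex attach i = vertex s i.
Proof. by move=> im; rewrite vertex_cat_l // size_m ltnS. Qed.

Lemma vertex_attach1 : vertex attach (m + 1) = (b, t1).
Proof. by rewrite addn1 -size_m -[size s]addn0 vertex_cat_r. Qed.

Lemma vertex_attach2 : vertex attach (m + 2) = (b', t1).
Proof. by rewrite addn2 -[m.+2]addn1 -size_m vertex_cat_r. Qed.

Lemma vertex_attach3 : vertex attach (m + 3) = (b', t2).
Proof. by rewrite addn3 -[m.+3]addn2 -size_m vertex_cat_r. Qed.

Lemma vertex_attach4 : vertex attach (m + 4) = (b, t2).
Proof. by rewrite addn4 -[m.+4]addn3 -size_m vertex_cat_r. Qed.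

Lemma vertex_attach5 : vertex attach (m + 5) = (b, q).
Proof. by rewrite -size_attach -[size _]add0n vertexDsize vertex_attach. Qed.

Lemma vertex_attach6 : vertex attach (m + 6) = vertex s 1.
Proof.
have -> : (m + 6 = 1 + size attach)%N by rewrite size_attach; lia.
by rewrite vertexDsize vertex_attach // ltnW ?m_gt1.
Qed.

Lemma vertex_m1 : vertex s m.+1 = (b, q).
Proof. by rewrite -size_m -[size s]add0n vertexDsize. Qed.

Lemma index_attach i : (i < size attach)%N ->
  (i < m)%N \/ exists2 k, (k < 5)%N & i = (m + k)%N.
Proof.
rewrite size_attach => i5; case: (ltnP i m) => im; [by left|right].
by exists (i - m)%N; lia.
Qed.

(* The sides numbered m to m + 4 of the new chain. *)
Definition new_side (k : nat) : plane * plane :=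
  nth ((b, p), (b, t1)) [:: ((b, p), (b, t1)); ((b, t1), (b', t1));
   ((b', t1), (b', t2)); ((b', t2), (b, t2)); ((b, t2), (b, q))] k.

Lemma new_sideE k : (k < 5)%N ->
  (vertex attach (m + k), vertex attach (m + k).+1) = new_side k.
Proof.
rewrite -addnS; move: k => [|[|[|[|[|//]]]]] _; rewrite /new_side /=.
- by rewrite addn0 vertex_attach // last_s vertex_attach1.
- by rewrite vertex_attach1 vertex_attach2.
- by rewrite vertex_attach2 vertex_attach3.
- by rewrite vertex_attach3 vertex_attach4.
- by rewrite vertex_attach4 vertex_attach5.
Qed.

Lemma old_side i : (i < m)%N ->
  vertex attach i = vertex s i /\ vertex attach i.+1 = vertex s i.+1.
Proof. by move=> im; rewrite !vertex_attach // ltnW. Qed.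

Lemma has_side_new k : (k < 5)%N -> has_side attach (new_side k).1 (new_side k).2.
Proof. by move=> /new_sideE <-; exists (m + k)%N. Qed.

Lemma has_side_old x y : has_side s x y ->
  has_side attach x y \/ x = (b, p) /\ y = (b, q).
Proof.
move=> [i <- <-]; rewrite -vertex_mod -vertexS_mod.
have : (i %% size s < m.+1)%N by rewrite -size_m ltn_mod size_m.
move: (i %% size s)%N => {}i; rewrite ltnS leq_eqVlt => /orP[/eqP ->|im].
  by right; rewrite last_s vertex_m1.
by left; exists i; have [] := old_side im.
Qed.

Lemma axis_parallel_attach : axis_parallel s -> axis_parallel attach.
Proof.
move=> axs; apply: axis_parallel_lizard; first by rewrite size_attach addnS.
have lb := bb'.
move=> i /index_attach[im|[k k5 ->]]; first by have [-> ->] := old_side im.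
have := new_sideE k5; set u := vertex _ _; set v := vertex _ _ => uv.
rewrite -[u]/(u, v).1 -[v]/(u, v).2 uv; apply/allowed_direction2P.
move: k k5 {u v uv} => [|[|[|[|[|//]]]]] _; rewrite /new_side /=;
  by split; [move=> []; case: order_t => -[]; lra|tauto].
Qed.

(** The first and last new sides run along the removed one, so the angles at its ends stay non-flat;
    the four new angles are right angles. *)
Lemma attach_noncollinear i : (i < size attach)%N ->
  ~ collinear (vertex attach i) (vertex attach i.+1) (vertex attach i.+2).
Proof.
have [[_ ncol _] _] := sP.
have pq : p != q by apply/eqP; case: order_t => -[]; lra.
move=> /index_attach[im|[k k5 ->]].
  have [im'|im'] := eqVneq i.+1 m.
    have /ncol : (i < size s)%N by rewrite size_m; lia.
    rewrite (vertex_attach (ltnW im)) im'.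
    have [e1 e2] : vertex attach m = (b, p) /\ vertex attach m.+1 = (b, t1).
      by have := new_sideE (isT : (0 < 5)%N); rewrite addn0 => -[-> ->].
    rewrite e1 e2 last_s vertex_m1 /collinear /=; case: (vertex s i) => u1 u2 /= nc.
    move=> /eqP; rewrite subrr mulr0 mulf_eq0 => /orP[]/eqP h.
      by apply: nc; rewrite h subrr mulr0 mul0r.
    by case: order_t => -[]; lra.
  have im2 : (i.+2 <= m)%N by lia.
  by rewrite !vertex_attach ?(ltnW im2) ?(ltnW im) //; apply: ncol; rewrite size_m; lia.
have [k3|k4] : (k.+1 < 5)%N \/ k = 4%N by lia.
  have := new_sideE k5; have := new_sideE k3; rewrite addnS.
  set u := vertex _ _; set v := vertex _ _; set w := vertex _ _ => vw uv.
  suff : ~ collinear (new_side k).1 (new_side k.+1).1 (new_side k.+1).2.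
    by rewrite -vw -[X in collinear X](congr1 fst uv).
  move: k k5 k3 {u v w uv vw} => [|[|[|[|//]]]] _ _; rewrite /collinear /new_side /=;
    rewrite !subrr ?mulr0 ?mul0r => /eqP; rewrite 1?(eq_sym 0) mulf_eq0 => /orP[]/eqP;
    case: order_t => -[]; have := bb'; lra.
have := ncol m; rewrite size_m ltnSn last_s vertex_m1 => /(_ isT) nc.
rewrite k4 -!addnS vertex_attach4 vertex_attach5 vertex_attach6.
move: nc; rewrite -size_m -[(size s).+1]add1n vertexDsize /collinear /=.
case: (vertex s 1) => u1 u2 /= nc /esym/eqP.
rewrite subrr mul0r mulf_eq0 => /orP[]/eqP h.
  by case: order_t => -[]; lra.
by apply: nc; rewrite h mulr0 subrr mul0r.
Qed.

Lemma attach_nondegenerate i : (i < size attach)%N ->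
  vertex attach i <> vertex attach i.+1.
Proof.
have [[_ _ /simple_chainP[nd _]] _] := sP.
move=> /index_attach[im|[k k5 ->]].
  by have [-> ->] := old_side im; apply: nd; rewrite size_m; lia.
have := new_sideE k5; set u := vertex _ _; set v := vertex _ _ => uv.
suff : (new_side k).1 <> (new_side k).2 by rewrite -uv.
by move: k k5 {uv u v} => [|[|[|[|[|//]]]]] _ [] /=; have := bb'; case: order_t => -[]; lra.
Qed.

Lemma attach_new_sides k l z : (k < l)%N -> (l < 5)%N ->
  hside (new_side k).1 (new_side k).2 z ->
  hside (new_side l).1 (new_side l).2 z -> False.
Proof.
have [n1 n2] : p <> t1 /\ t1 <> t2 by case: order_t => -[]; lra.
have [n3 n4] : b <> b' /\ b' <> b by have := bb'; lra.
have n5 : t2 <> q by case: order_t => -[]; lra.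
move: k l => [|[|[|[|k]]]] [|[|[|[|[|l]]]]] //= _ _;
  rewrite ?hsideH ?hsideV //; have := bb'; case: order_t => -[]; lra.
Qed.

Lemma in_P_right z : P z -> b < z.1 -> z.1 <= b' -> lo <= z.2 -> z.2 <= hi -> False.
Proof. by case: z => x y /= Pz x1 x2 y1 y2; apply: (@freeP x y _ _ _ _ Pz); have := e0gt0; lra. Qed.

(** Gathers what simplicity and the boundary need, uniformly in the five sides: they avoid the new
    open box, and they lie on the glued box or on the removed side. *)
Lemma new_sideP k z : (k < 5)%N -> side (new_side k).1 (new_side k).2 z ->
  [/\ b <= z.1 /\ z.1 <= b', z.1 = b' \/ z.2 <= lo \/ hi <= z.2,
      b < z.1 -> lo <= z.2 /\ z.2 <= hi & z.1 = b -> side (b, p) (b, q) z].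
Proof.
have lb := bb'.
move: k z => [|[|[|[|[|//]]]]] [x y] _; rewrite /new_side /=.
all: rewrite ?sideH ?sideV /= => h; case: order_t => -[? ? ? ? ?].
all: by split; first [lra | move=> ?; apply/sideV => /=; lra].
Qed.

Lemma attach_simple : simple_chain attach.
Proof.
have [[_ _ /simple_chainP[_ dis]] _] := sP.
apply/simple_chainP; split=> [i|i j z ij]; first exact: attach_nondegenerate.
have P_old i' u : (i' < m)%N -> side (vertex s i') (vertex s i'.+1) u -> P u.
  move=> im zi; have [] // := @polygon_boundary _ _ _ u sP _.
  by apply: closed_chain_side zi; rewrite size_m.
have old_new i' k u : (i' < m)%N -> (k < 5)%N ->
    hside (vertex s i') (vertex s i'.+1) u ->
    hside (new_side k).1 (new_side k).2 u -> False.
  move=> im k5 ui uk.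
  have Pu := P_old _ _ im (hside_side ui).
  have [[u1 u2] uW uB ub] := new_sideP k5 (hside_side uk).
  have [h|h] := eqVneq u.1 b; last first.
    have h' : b < u.1 by rewrite lt_def h.
    by apply: (in_P_right Pu) => //; case: (uB h').
  have pq : p <> q by case: order_t => -[]; lra.
  (* A common point with abscissa [b] would lie on the removed side, which the other old sides do
     not meet. *)
  have : hside (vertex s m) (vertex s m.+1) u.
    rewrite last_s vertex_m1.
    have /sideV[_ us] := ub h.
    apply/hsideV => //; split => //.
    move: uk us; rewrite /new_side; move: k k5 => [|[|[|[|[|//]]]]] _ /=;
      have lb := bb'; rewrite ?hsideH ?hsideV; case: order_t => -[]; lra.
  by move=> um; apply: dis ui um => //; rewrite size_m.
move=> js; have /index_attach[jm|[l l5 jE]] := js.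
  have im : (i < m)%N by exact: ltn_trans jm.
  have [-> ->] := old_side im; have [-> ->] := old_side jm.
  by apply: dis => //; rewrite size_m; lia.
have jE' := new_sideE l5.
have [im|im] := ltnP i m.
  have [-> ->] := old_side im; subst j => zi zj.
  by apply: (old_new _ _ _ im l5 zi); rewrite -jE'.
have [k iE] : exists k, i = (m + k)%N by exists (i - m)%N; lia.
subst i j; rewrite ltn_add2l in ij.
have iE' := new_sideE (ltn_trans ij l5).
move=> zi zj; apply: (@attach_new_sides k l z) => //.
  by rewrite -iE'.
by rewrite -jE'.
Qed.

Local Notation P' := (P `|` box b b' lo hi).
Local Notation W := (obox a b' lo hi).

Lemma lohi : lo < hi. Proof. by case: order_t => -[]; lra. Qed.

Lemma compact_attach : compact P'.
Proof. by apply: compactU; [case: sP => _ []|exact: compact_box]. Qed.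

Lemma W_sub : W `<=` P'.
Proof.
move=> z [z1 z2 z3 z4]; have [h|h] := lerP z.1 b; [left|right].
  by apply: aP; split; lra.
by split; lra.
Qed.

(** [W] starts at [a], inside [P], in order to contain the open segment of the closing side that the
    gluing makes interior. *)
Lemma interior_attach : interior P' = interior P `|` W.
Proof.
have lb := bb'; have lh := lohi; have le := e0gt0.
apply/seteqP; split=> z; last first.
  move=> [|Wz]; first by apply: filterS => w; left.
  by apply: filterS W_sub _; apply: open_nbhs_nbhs; split => //; exact: open_obox.
move=> Pz; have [Wz|nWz] := pselect (W z); [by right|left].
have [Bz|nBz] := pselect (box b b' lo hi z); last first.
  have nB : nbhs z (~` box b b' lo hi).
    by apply: open_nbhs_nbhs; split => //; apply: closed_openC; exact: closed_box.
  by apply: filterS (filterI Pz nB) => w [[]].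
exfalso; move/nbhs_planeP: Pz => [e e1 eP].
pose r := Num.min e e0 / 2.
have [re re0] : r <= e / 2 /\ r <= e0 / 2.
  by rewrite /r; split; rewrite ler_pM2r ?invr_gt0 // ge_min lexx ?orbT.
have r0 : 0 < r by rewrite /r divr_gt0 // lt_min e1 e0gt0.
(* Here [z] is on the right, bottom or top side of the glued box. The step also goes to the right,
   since [freeP] only speaks of abscissas beyond [b]. *)
have [x [y [? ? ? ? nP']]] : exists x y, [/\ z.1 - e < x, x < z.1 + e, z.2 - e < y,
    y < z.2 + e & [/\ b < x, x <= b' + e0, lo - e0 <= y, y <= hi + e0 &
    b' < x \/ y < lo \/ hi < y]].
  case: Bz => z1 z2 z3 z4; have al := ab.
  have [z1E|h1] := eqVneq z.1 b'.
    by exists (z.1 + r), z.2; split; try lra; split; try lra; left; lra.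
  have [z2E|h2] := eqVneq z.2 lo.
    by exists (z.1 + r), (z.2 - r); split; try lra; split; try lra; right; left; lra.
  have [z3E|h3] := eqVneq z.2 hi.
    by exists (z.1 + r), (z.2 + r); split; try lra; split; try lra; right; right; lra.
  case: nWz; split; [lra| | |]; rewrite lt_def; apply/andP; split => //; by rewrite eq_sym.
case: nP' => ? ? ? ? nB.
have [|[/= ? ? ? ?]] : P' (x, y) by exact: eP.
  exact: freeP.
by case: nB => [|[]]; lra.
Qed.

Lemma connected_attach : connected (interior P').
Proof.
rewrite interior_attach; apply: connectedU.
- exists ((a + b) / 2, (lo + hi) / 2); have [la [lb lh]] := (ab, (bb', lohi)).
  split; last by split => /=; lra.
  apply: (interiorS aP); rewrite interior_box; split => /=; lra.
- by case: sP => _ [].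
- exact: connected_obox.
Qed.

Lemma regular_attach : P' = closure (interior P').
Proof.
have cP' : closed P' by exact: compact_closed (@plane_hausdorff R) compact_attach.
apply/seteqP; split; last first.
  rewrite [X in _ `<=` X](iffLR (closure_id _) cP').
  by apply: closure_subset; exact: interior_subset.
rewrite interior_attach closureU closure_obox ?lohi ?(lt_trans ab) //.
apply: setUSS; first by case: sP => _ [_ _ <- _].
by move=> z [? ? ? ?]; have := ab; split; lra.
Qed.

Lemma closed_chain_attach z : closed_chain attach z <->
  (exists2 i, (i < m)%N & side (vertex s i) (vertex s i.+1) z) \/
  (exists2 k, (k < 5)%N & side (new_side k).1 (new_side k).2 z).
Proof.
rewrite closed_chainP; split.
  move=> [i /index_attach[im|[k k5 ->]]].
    by have [-> ->] := old_side im; left; exists i.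
  by move=> h; right; exists k => //; rewrite -new_sideE.
move=> [[i im zi]|[k k5 zk]].
  exists i; first by rewrite size_attach; lia.
  by have [-> ->] := old_side im.
exists (m + k)%N; first by rewrite size_attach ltn_add2l.
by move: zk; rewrite -new_sideE.
Qed.

(** Left of the closing side [W] is interior to [P], right of it [P] is absent, and on it another
    old side would violate simplicity. *)
Lemma old_side_notW i z : (i < m)%N -> side (vertex s i) (vertex s i.+1) z -> ~ W z.
Proof.
move=> im zi [z1 z2 z3 z4].
have [[_ _ /simple_chainP[_ dis]] _] := sP.
have [Pz nPz] : P z /\ ~ nbhs z P.
  by apply: (polygon_boundary sP); apply: closed_chain_side zi; rewrite size_m.
have pq : p <> q by case: order_t => -[]; lra.
have [h|h|h] := ltgtP z.1 b.
- by apply: nPz; apply: (interiorS aP); rewrite interior_box.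
- by apply: (in_P_right Pz) => //; apply: ltW.
have zm : hside (vertex s m) (vertex s m.+1) z.
  rewrite last_s vertex_m1 hsideV //; split => //.
  by case: order_t => -[? ? ? ? ?]; [left|right]; split; lra.
have [zi'|zE] := side_hside zi.
  by apply: dis zi' zm => //; rewrite size_m.
(* The end of side [i] is the start of the next side; if that is the closing side, the point is
   [(b, p)], outside the heights of [W]. *)
have [im'|im'] := eqVneq i.+1 m.
  by move: zE; rewrite im' last_s => zE; move: z3 z4; rewrite zE /=; case: order_t => -[]; lra.
have : hside (vertex s i.+1) (vertex s i.+2) z.
  exists 0; split => //; rewrite zE; case: (vertex s i.+1) => ? ?.
  by congr (_, _) => /=; lra.
move=> zi'; apply: dis zi' zm; last by rewrite size_m.
by lia.
Qed.

Lemma boundary_attach : boundary P' = closed_chain attach.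
Proof.
have cP' : closed P' by exact: compact_closed (@plane_hausdorff R) compact_attach.
have [_ [_ _ _ bP]] := sP.
have pq : p <> q by case: order_t => -[]; lra.
rewrite /boundary interior_attach -(iffLR (closure_id _) cP').
apply/seteqP; split=> z.
  move=> [P'z /not_orP[nPz nWz]]; apply/closed_chain_attach.
  have [Pz|nP] := pselect (P z).
    have /closed_chainP[i] : closed_chain s z.
      by rewrite -bP; split => //; exact: subset_closure.
    rewrite size_m ltnS leq_eqVlt => /orP[/eqP ->|im zi]; last by left; exists i.
    rewrite last_s vertex_m1 => /sideV[zb zpq]; right.
    have nlh : z.2 <= lo \/ hi <= z.2.
      have [h|h] := lerP z.2 lo; [by left|right].
      have [//|h'] := lerP hi z.2; case: nWz; have := ab; have := bb'; split => //; lra.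
    have [h|h] : (p <= z.2 /\ z.2 <= t1 \/ t1 <= z.2 /\ z.2 <= p) \/
        (t2 <= z.2 /\ z.2 <= q \/ q <= z.2 /\ z.2 <= t2).
      by case: order_t => -[? ? ? ? ?]; case: nlh => ?; case: zpq => -[? ?]; lra.
    - by exists 0%N => //; apply/sideV.
    - by exists 4%N => //; apply/sideV.
  case: P'z => // -[z1 z2 z3 z4]; right.
  have [h1|h1] := eqVneq z.1 b'.
    exists 2%N => //; apply/sideV; split => //.
    by case: order_t => -[? ? ? e1 e2]; [left|right]; split; lra.
  have hW : z.2 <= lo \/ hi <= z.2.
    have [h|h] := lerP z.2 lo; [by left|right].
    have [//|h'] := lerP hi z.2; case: nWz; have := ab; split => //; first by lra.
    by rewrite lt_def eq_sym h1.
  have [h|h] : z.2 = t1 \/ z.2 = t2.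
    by case: order_t => -[? ? ? ? ?]; case: hW => ?; first [left; lra | right; lra].
  - by exists 1%N => //; apply/sideH; split => //; left.
  - by exists 3%N => //; apply/sideH; split => //; right.
move=> /closed_chain_attach[[i im zi]|[k k5 zk]].
  have [Pz nPz] : P z /\ ~ nbhs z P.
    by apply: (polygon_boundary sP); apply: closed_chain_side zi; rewrite size_m.
  by split; [left|move=> [//|]; exact: old_side_notW zi].
have [[z1 z2] zW zB zb] := new_sideP k5 zk.
have nW : ~ W z by move=> [? ? ? ?]; case: zW => [|[]]; lra.
have [h|h] := eqVneq z.1 b.
  have [Pz nPz] : P z /\ ~ nbhs z P.
    apply: (polygon_boundary sP); apply: (@closed_chain_side _ _ m); first by rewrite size_m.
    by rewrite last_s vertex_m1; exact: zb.
  by split; [left|move=> []].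
have h' : b < z.1 by rewrite lt_def h.
have [z3 z4] := zB h'.
split; first by right.
move=> [/interior_subset Pz|//].
exact: in_P_right Pz h' z2 z3 z4.
Qed.

Lemma attach_polygon : polygon_with_vertices attach P'.
Proof.
split; split.
- by rewrite size_attach; lia.
- exact: attach_noncollinear.
- exact: attach_simple.
- exact: compact_attach.
- exact: connected_attach.
- exact: regular_attach.
- exact: boundary_attach.
Qed.

End Attach.

(** * Rectangles with slots, and the invariant of the construction *)

Section Layout.
Variable R : realType.
Notation plane := (R * R)%type.
Implicit Types (z : plane) (P : set plane) (s : seq plane).

Record rect := Rect { xl : R; xr : R; yl : R; yr : R }.

Definition rect_tp (r : rect) : rect := Rect (yl r) (yr r) (xl r) (xr r).

Definition rbox (r : rect) : set plane := box (xl r) (xr r) (yl r) (yr r).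

Definition robox (r : rect) : set plane := obox (xl r) (xr r) (yl r) (yr r).

Lemma rbox_tp r : rbox (rect_tp r) = @tp R @^-1` rbox r.
Proof. by rewrite box_tp. Qed.

Lemma robox_tp r : robox (rect_tp r) = @tp R @^-1` robox r.
Proof. by apply/seteqP; split=> -[x y] [/= ? ? ? ?]; split. Qed.

(* A slot of a rectangle is a horizontal strip [slo, shi] across it, or a
   vertical one when [upward] holds; a further rectangle can be attached at its
   right (upper) end. *)
Record slot := Slot { upward : bool; slo : R; shi : R; margin : R }.

Definition slot_tp (t : slot) : slot :=
  Slot (~~ upward t) (slo t) (shi t) (margin t).

(** The strip prolonged by its margin at both ends: the room reserved for later gluing. *)
Definition region (r : rect) (t : slot) : set plane :=
  if upward t then box (slo t) (shi t) (yl r - margin t) (yr r + margin t)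
  else box (xl r - margin t) (xr r + margin t) (slo t) (shi t).

Lemma region_tp r t : region (rect_tp r) (slot_tp t) = @tp R @^-1` region r t.
Proof. by rewrite /region /=; case: (upward t); rewrite /= box_tp. Qed.

(** The last clause places the end of the strip strictly inside a side of the polygon, traversed in
    either direction. *)
Definition right_slot s P (r : rect) (lo hi D : R) : Prop :=
  [/\ [/\ 0 < D, yl r <= lo, lo < hi & hi <= yr r],
      P `&` box (xl r - D) (xr r + D) lo hi `<=` rbox r
    & exists p q, has_side s (xr r, p) (xr r, q) /\
        (p < lo /\ hi < q \/ q < lo /\ hi < p)].

Definition good_slot s P (r : rect) (t : slot) : Prop :=
  if upward t
  then right_slot (map (@tp R) s) (@tp R @^-1` P) (rect_tp r) (slo t) (shi t) (margin t)
  else right_slot s P r (slo t) (shi t) (margin t).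

Lemma map_tpK s : map (@tp R) (map (@tp R) s) = s.
Proof. by rewrite mapK //; exact: tpK. Qed.

Lemma good_slot_tp s P r t : good_slot s P r t ->
  good_slot (map (@tp R) s) (@tp R @^-1` P) (rect_tp r) (slot_tp t).
Proof.
rewrite /good_slot /=; case: (upward t) => //=.
rewrite map_tpK; case: r => *.
by have -> : @tp R @^-1` (@tp R @^-1` P) = P by apply/seteqP; split=> -[].
Qed.

Lemma good_slot_rot1 s P r t : (0 < size s)%N ->
  good_slot s P r t -> good_slot (rot 1 s) P r t.
Proof.
move=> s0; rewrite /good_slot map_rot; case: (upward t) => -[h1 h2 [p [q [pq h3]]]];
  split => //; exists p, q; split => //; apply: has_side_rot1 => //.
by rewrite size_map.
Qed.

Variables (V : finType) (e : rel V).
Implicit Types (A : {set V}) (r : V -> rect) (t : V -> slot).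

(** [layout_max] speaks of all boxes in [P], a form of maximality that passes through a gluing. By
    [layout_private] even the slots of adjacent vertices are disjoint. *)
Record layout A s P r t : Prop := Layout {
  layout_polygon : polygon_with_vertices s P;
  layout_axis : axis_parallel s;
  layout_rect : forall v, v \in A ->
    [/\ xl (r v) < xr (r v), yl (r v) < yr (r v) & rbox (r v) `<=` P];
  layout_max : forall a b c d, a < b -> c < d -> box a b c d `<=` P ->
    exists2 v, v \in A & box a b c d `<=` rbox (r v);
  layout_edge : forall u v, u \in A -> v \in A -> u != v ->
    (e u v <-> robox (r u) `&` robox (r v) !=set0);
  layout_slot : forall v, v \in A -> good_slot s P (r v) (t v);
  layout_private : forall u v, u \in A -> v \in A -> u != v ->
    region (r u) (t u) `&` rbox (r v) = set0 /\
    region (r u) (t u) `&` region (r v) (t v) = set0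
}.

Lemma tp_setI0 (A B : set plane) : A `&` B = set0 ->
  (@tp R @^-1` A) `&` (@tp R @^-1` B) = set0.
Proof. by move=> h; rewrite -preimage_setI h preimage_set0. Qed.

Lemma layout_tp A s P r t : layout A s P r t ->
  layout A (map (@tp R) s) (@tp R @^-1` P) (rect_tp \o r) (slot_tp \o t).
Proof.
case=> h1 h2 h3 h4 h5 h6 h7; split => /=.
- exact: polygon_with_vertices_tp.
- exact: axis_parallel_tp.
- move=> v /h3[xx yy rP]; split => //.
  by rewrite rbox_tp; exact: preimage_subset.
- move=> a b c d ab cd sub; have [|v vA vP] := h4 c d a b cd ab.
    by move=> [x y] [/= ? ? ? ?]; apply: (sub (y, x)); split.
  by exists v => //; rewrite -[box a _ _ _]box_tp rbox_tp; exact: preimage_subset.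
- move=> u v uA vA uv; rewrite (h5 _ _ uA vA uv) !robox_tp -preimage_setI.
  by split=> [[[x y] xy]|[[x y] xy]]; exists (y, x).
- by move=> v /h6; exact: good_slot_tp.
- by move=> u v uA vA uv; rewrite !region_tp !rbox_tp; have [? ?] := h7 _ _ uA vA uv; split; exact: tp_setI0.
Qed.

Lemma layout_rot A s P r t k : layout A s P r t -> layout A (iter k (rot 1) s) P r t.
Proof.
elim: k => //= k IH /IH {IH}; move: (iter _ _ _) => {}s.
case=> h1 h2 h3 h4 h5 h6 h7; split => //.
- exact: polygon_with_vertices_rot1.
- by move=> i; rewrite !vertex_rot1.
- move=> v /h6; apply: good_slot_rot1.
  by case: h1 => -[s3 _ _] _; exact: leq_trans s3.
Qed.

Lemma vertex_iter_rot1 s k i : vertex (iter k (rot 1) s) i = vertex s (i + k).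
Proof.
elim: k i => [|k IH] i /=; first by rewrite addn0.
by rewrite vertex_rot1 IH addSnnS.
Qed.

Lemma layout_last A s P r t p q : layout A s P r t -> has_side s p q ->
  exists s', [/\ layout A s' P r t, vertex s' (size s').-1 = p & vertex s' 0 = q].
Proof.
move=> L [i ip iq]; exists (iter i.+1 (rot 1) s).
have sz : size (iter i.+1 (rot 1) s) = size s.
  by elim: (i.+1) => //= k; rewrite size_rot.
have s0 : (0 < size s)%N by have [[s3 _ _] _] := layout_polygon L; exact: leq_trans s3.
split; first exact: layout_rot.
  by rewrite vertex_iter_rot1 sz addnS -addSn prednK // addnC vertexDsize.
by rewrite vertex_iter_rot1 add0n.
Qed.

End Layout.

(** * Adding one leaf to a layout *)

Section Growth.
Variable R : realType.
Notation plane := (R * R)%type.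
Implicit Types (z : plane) (P : set plane) (s : seq plane).

Lemma intervals_meet (a b c d : R) : a < b -> c < d -> a < d -> c < b ->
  exists x, [/\ a < x, x < b, c < x & x < d].
Proof.
move=> ab cd ad cb; case: (lerP a c) => ac; case: (lerP b d) => bd.
- by exists ((c + b) / 2); split; lra.
- by exists ((c + d) / 2); split; lra.
- by exists ((a + b) / 2); split; lra.
- by exists ((a + d) / 2); split; lra.
Qed.

(* A rectangle violating the conclusion contains a point of the strip
   [a - D, b + D] x [lo0, hi0] that is neither in P nor in the glued box. *)
Lemma box_in_attach P (a b b' D lo0 lo hi hi0 x1 x2 y1 y2 : R) :
  a < b -> b < b' -> b' < b + D -> 0 < D -> lo0 < lo -> lo < hi -> hi < hi0 ->
  box a b lo hi `<=` P ->
  (forall x y, P (x, y) -> a - D <= x -> x <= b + D -> lo0 <= y -> y <= hi0 ->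
    a <= x /\ x <= b) ->
  x1 < x2 -> y1 < y2 -> box x1 x2 y1 y2 `<=` P `|` box b b' lo hi ->
  box x1 x2 y1 y2 `<=` P \/ box x1 x2 y1 y2 `<=` box a b' lo hi.
Proof.
move=> ab bb' b'D D0 lo0lo lohi hihi0 aP stripP x12 y12 TP.
have bad x y : x1 <= x -> x <= x2 -> y1 <= y -> y <= y2 ->
    a - D < x -> x < b + D -> lo0 < y -> y < hi0 -> (x < a \/ b < x) ->
    [\/ x < b, b' < x, y < lo | hi < y] -> False.
  move=> ? ? ? ? ? ? ? ? xab out; have [Pxy|[/= ? ? ? ?]] : (P `|` box b b' lo hi) (x, y) by apply: TP; split.
    have [? ?] : a <= x /\ x <= b by apply: (stripP x y Pxy); apply: ltW.
    by lra.
  by case: out; lra.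
(* These are the cases in which the two boxes have disjoint interiors. A point of the glued box
   beyond [b] then lies on its edge, and the rectangle continues outside. *)
have [nov|] := pselect (b' <= x1 \/ hi <= y1 \/ y2 <= lo \/ x2 <= b).
  left=> z Tz; have [//|Bz] := TP z Tz.
  case: z Tz Bz => x y [/= xx1 xx2 yy1 yy2] [/= bx xb' loy yhi].
  have [xb|xb] := eqVneq x b; first by apply: aP; split => /=; lra.
  have {xb bx}bx : b < x by rewrite lt_def xb.
  exfalso; case: nov => [h|[h|[h|h]]].
  - have [x' [? ? ? ?]] := @intervals_meet x1 x2 b' (b + D) x12 b'D ltac:(lra) ltac:(lra).
    by apply: (bad x' y); last (by apply: Or42); first [done | by apply: ltW | lra].
  - have [y' [? ? ? ?]] := @intervals_meet y1 y2 hi hi0 y12 hihi0 ltac:(lra) ltac:(lra).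
    by apply: (bad x y'); last (by apply: Or44); first [done | by apply: ltW | lra].
  - have [y' [? ? ? ?]] := @intervals_meet y1 y2 lo0 lo y12 lo0lo ltac:(lra) ltac:(lra).
    by apply: (bad x y'); last (by apply: Or43); first [done | by apply: ltW | lra].
  - by lra.
move=> /not_orP[/negP + /not_orP[/negP + /not_orP[/negP + /negP]]].
rewrite -!ltNge => o1 o2 o3 o4; right.
(* Moving one coordinate of a common interior point across a bound that the rectangle violates
   yields a [bad] point. *)
have [x [? ? ? ?]] := intervals_meet x12 bb' o1 o4.
have [y [? ? ? ?]] := intervals_meet y12 lohi o2 o3.
have c1 : lo <= y1.
  rewrite leNgt; apply/negP => h.
  have [y' [? ? ? ?]] := @intervals_meet y1 y2 lo0 lo y12 lo0lo h ltac:(lra).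
  by apply: (bad x y'); last (by apply: Or43); first [done | by apply: ltW | lra].
have c2 : y2 <= hi.
  rewrite leNgt; apply/negP => h.
  have [y' [? ? ? ?]] := @intervals_meet y1 y2 hi hi0 y12 hihi0 ltac:(lra) h.
  by apply: (bad x y'); last (by apply: Or44); first [done | by apply: ltW | lra].
have c3 : x2 <= b'.
  rewrite leNgt; apply/negP => h.
  have [x' [? ? ? ?]] := @intervals_meet x1 x2 b' (b + D) x12 b'D ltac:(lra) h.
  by apply: (bad x' y); last (by apply: Or42); first [done | by apply: ltW | lra].
(* This bound rests on the strip leaving the polygon at its left end. *)
have c4 : a <= x1.
  rewrite leNgt; apply/negP => h.
  have [x' [? ? ? ?]] := @intervals_meet x1 x2 (a - D) a x12 ltac:(lra) h ltac:(lra).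
  by apply: (bad x' y); last (by apply: Or41; lra); first [done | by apply: ltW | lra].
by move=> z [? ? ? ?]; split; lra.
Qed.

(** Meant for the rectangles other than that of [v]: nothing is added in their regions, but the side
    at the end of their slot may have been cut. *)
Lemma right_slot_transfer s P s1 P1 (r : rect R) (lo hi D : R) :
  P1 `&` box (xl r - D) (xr r + D) lo hi `<=` P ->
  (forall p q, (p < lo /\ hi < q \/ q < lo /\ hi < p) ->
    has_side s (xr r, p) (xr r, q) ->
    exists p' q', has_side s1 (xr r, p') (xr r, q') /\
      (p' < lo /\ hi < q' \/ q' < lo /\ hi < p')) ->
  right_slot s P r lo hi D -> right_slot s1 P1 r lo hi D.
Proof.
move=> P1P ss1 [h1 h2 [p [q [pq h3]]]]; split => //; last exact: ss1 pq.
by move=> z [P1z zb]; apply: h2; split => //; apply: P1P.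
Qed.

Variables (V : finType) (e : rel V).

Lemma layout_step_right (A : {set V}) s P r t v w :
  symmetric e -> layout e A s P r t -> v \in A -> w \notin A ->
  (forall u, u \in A -> e u w = (u == v)) -> ~~ upward (t v) ->
  exists s' P' r' t', layout e (w |: A) s' P' r' t'.
Proof.
move=> esym L0 vA wA ew up.
have [ab cd rP] := layout_rect L0 vA.
have := layout_slot L0 vA; rewrite /good_slot (negbTE up).
move=> [[D0 clo lohi0 hid] slotP [p [q [side_pq pq]]]].
have [s2 [L last_s head_s]] := layout_last L0 side_pq.
clear L0 side_pq s; rename s2 into s.
have regv : region (r v) (t v) = box (xl (r v) - margin (t v)) (xr (r v) + margin (t v))
    (slo (t v)) (shi (t v)) by rewrite /region (negbTE up).
have priv u : u \in A -> u != v -> [/\ region (r v) (t v) `&` rbox (r u) = set0,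
    region (r u) (t u) `&` rbox (r v) = set0 & region (r v) (t v) `&` region (r u) (t u) = set0].
  move=> uA uv; have [? ?] := layout_private L uA vA uv.
  by rewrite eq_sym in uv; have [? ?] := layout_private L vA uA uv; split.
have rvE : rbox (r v) = box (xl (r v)) (xr (r v)) (yl (r v)) (yr (r v)) by [].
move: ab cd rP D0 clo lohi0 hid slotP pq last_s head_s regv rvE.
set a := xl (r v); set b := xr (r v); set c := yl (r v); set d := yr (r v).
set lo0 := slo (t v); set hi0 := shi (t v); set D := margin (t v).
move=> ab cd rP D0 clo lohi0 hid slotP pq last_s head_s regv rvE.
(* Of five equal layers of the slot, the second carries the glued box and the fourth becomes the new
   slot of [v]; the others are gaps. *)
pose h := (hi0 - lo0) / 5; have h0 : 0 < h by rewrite /h; lra.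
have hE : hi0 = lo0 + 5 * h by rewrite /h; lra.
pose lo := lo0 + h; pose hi := lo0 + 2 * h; pose b' := b + D / 2.
have loE : lo = lo0 + h by []. have hiE : hi = lo0 + 2 * h by [].
have b'E : b' = b + D / 2 by [].
have lohi : lo < hi by lra.
have bb' : b < b' by lra.
(* The glued box uses half of the margin [D]; with this clearance its surroundings stay in the old
   region of [v]. *)
have [e0 [e00 e0D e0h]] : exists e0, [/\ 0 < e0, e0 <= D / 2 & e0 <= h].
  exists (Num.min (D / 2) h); rewrite !ge_min !lexx orbT; split => //.
  by rewrite lt_min h0 andbT; lra.
have [t1 [t2 ord]] : exists t1 t2, [/\ p < t1, t1 < t2, t2 < q, lo = t1 & hi = t2] \/
    [/\ q < t2, t2 < t1, t1 < p, lo = t2 & hi = t1].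
  case: pq => -[? ?].
    by exists lo, hi; left; split => //; lra.
  by exists hi, lo; right; split => //; lra.
have stripP x y : P (x, y) -> a - D <= x -> x <= b + D -> lo0 <= y -> y <= hi0 ->
    a <= x /\ x <= b.
  move=> Pxy ? ? ? ?.
  by have [/= ? ? _ _] : rbox (r v) (x, y) by apply: slotP; split.
have aP : box a b lo hi `<=` P.
  by move=> z [? ? ? ?]; apply: rP; split; rewrite -?/a -?/b -?/c -?/d; lra.
have freeP x y : b < x -> x <= b' + e0 -> lo - e0 <= y -> y <= hi + e0 -> ~ P (x, y).
  move=> ? ? ? ? Pxy; have [? ?] : a <= x /\ x <= b by apply: (stripP x y Pxy); lra.
  by lra.
have poly := layout_polygon L.
pose s1 := attach s b b' t1 t2.
pose P1 : set plane := P `|` box b b' lo hi.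
have sP1 : polygon_with_vertices s1 P1.
  exact: (attach_polygon poly last_s head_s ord ab bb' aP e00 freeP).
have side_new k : (k < 5)%N ->
    has_side s1 (new_side b b' p q t1 t2 k).1 (new_side b b' p q t1 t2 k).2.
  by move=> k5; exact: (has_side_new _ _ _ poly last_s head_s k5).
have side_old x y : has_side s x y -> has_side s1 x y \/ x = (b, p) /\ y = (b, q).
  by move=> xy; exact: (has_side_old _ _ _ poly last_s head_s xy).
have axis1 : axis_parallel s1.
  exact: (axis_parallel_attach poly last_s head_s ord ab bb' e00 (layout_axis L)).
pose rw := Rect a b' lo hi.
(* The middle half of the protruding part, which has width [D / 2]; the margin [h / 2] ends below
   the fourth layer. *)
pose tw := Slot true (b + D / 8) (b + 3 * D / 8) (h / 2).
pose tv := Slot false (lo0 + 3 * h) (lo0 + 4 * h) D.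
have rwE : rbox rw = box a b' lo hi by [].
have twE : region rw tw = box (b + D / 8) (b + 3 * D / 8) (lo - h / 2) (hi + h / 2) by [].
have tvE : region (r v) tv = box (a - D) (b + D) (lo0 + 3 * h) (lo0 + 4 * h) by [].
(* Everything new lies in the old region of [v], so disjointness from the other rectangles and slots
   is inherited. *)
have rwreg : rbox rw `<=` region (r v) (t v).
  rewrite regv => z [/= H H0 H1 H2].
  by clear -ab D0 h0 loE hiE hE b'E H H0 H1 H2; split; lra.
have Breg : box b b' lo hi `<=` region (r v) (t v).
  move=> z [z1 z2 z3 z4]; apply: rwreg; split => //.
  exact: le_trans (ltW ab) z1.
have twreg : region rw tw `<=` region (r v) (t v).
  rewrite regv twE => z [/= H H0 H1 H2].
  by clear -ab D0 h0 loE hiE hE b'E H H0 H1 H2; split; lra.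
have tvreg : region (r v) tv `<=` region (r v) (t v).
  rewrite regv tvE => z [/= H H0 H1 H2].
  by clear -ab D0 h0 loE hiE hE b'E H H0 H1 H2; split; lra.
have twrv : region rw tw `&` rbox (r v) = set0.
  rewrite ?twE ?tvE ?rwE ?rvE -subset0 => z [[/= H _ _ _] [_ H0 _ _]].
  by clear -D0 H H0; exfalso; lra.
have twtv : region rw tw `&` region (r v) tv = set0.
  rewrite ?twE ?tvE ?rwE ?rvE -subset0 => z [[/= _ _ _ H] [/= _ _ H0 _]].
  by clear -h0 hiE H H0; exfalso; lra.
have tvrw : region (r v) tv `&` rbox rw = set0.
  rewrite ?twE ?tvE ?rwE ?rvE -subset0 => z [[/= _ _ H _] [/= _ _ _ H0]].
  by clear -h0 hiE H H0; exfalso; lra.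
have rwP1 : rbox rw `<=` P1.
  move=> z [/= ? ? ? ?]; have [zb|zb] := lerP z.1 b; first by left; apply: aP; split.
  by right; split => //; exact: ltW.
have vw : v != w by apply: contraNneq wA => <-.
pose r1 u := if u == w then rw else r u.
pose tt1 u := if u == w then tw else if u == v then tv else t u.
have r1w : r1 w = rw by rewrite /r1 eqxx.
have tt1w : tt1 w = tw by rewrite /tt1 eqxx.
have nw u : u \in A -> u == w = false by apply: contraTF => /eqP ->.
have r1A u : u \in A -> r1 u = r u by move=> uA; rewrite /r1 nw.
have tt1v : tt1 v = tv by rewrite /tt1 nw // eqxx.
have tt1A u : u \in A -> u != v -> tt1 u = t u.
  by move=> uA /negbTE uv; rewrite /tt1 nw // uv.
have reg1 u : u \in A -> region (r1 u) (tt1 u) `<=` region (r u) (t u).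
  move=> uA; have [->|uv] := eqVneq u v; first by rewrite r1A // tt1v.
  by rewrite r1A // tt1A.
have meet_vw : robox (r v) `&` robox rw !=set0.
  exists ((a + b) / 2, (lo + hi) / 2); split; split; rewrite /= -?/a -?/b -?/c -?/d;
    clear -ab D0 h0 loE hiE hE b'E clo hid; lra.
have apart u : u \in A -> u != v -> ~ (robox (r u) `&` robox rw !=set0).
  move=> uA uv [z [zu zw]]; have [h1 _ _] := priv u uA uv.
  rewrite -[False]/(set0 z) -h1; split.
    by apply: rwreg; move: zw => [? ? ? ?]; split; exact: ltW.
  by move: zu => [? ? ? ?]; split; exact: ltW.
exists s1, P1, r1, tt1; split => //.
- move=> u; rewrite in_setU1 => /orP[/eqP ->|uA].
    by rewrite r1w /=; split => //; exact: lt_trans bb'.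
  rewrite r1A //; have [? ? uP] := layout_rect L uA; split => //.
  by move=> z zu; left; exact: uP.
- move=> x1 x2 y1 y2 x12 y12 sub.
  have [sP'|sw] : box x1 x2 y1 y2 `<=` P \/ box x1 x2 y1 y2 `<=` box a b' lo hi.
    apply: (@box_in_attach P a b b' D lo0 lo hi hi0) => //;
      clear -D0 h0 loE hiE hE b'E; lra.
  + have [u uA us] := layout_max L x12 y12 sP'.
    by exists u; [rewrite in_setU1 uA orbT|rewrite r1A].
  + by exists w; [rewrite in_setU1 eqxx|rewrite r1w].
- move=> u u'; rewrite !in_setU1 => /orP[/eqP ->|uA] /orP[/eqP ->|u'A] uu'.
  + by rewrite eqxx in uu'.
  + rewrite esym ew // r1w r1A // setIC; split => [/eqP -> //|].
    by move=> ne; have [//|u'v] := eqVneq u' v; case: (apart u' u'A u'v ne).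
  + rewrite ew // r1w r1A //; split => [/eqP -> //|].
    by move=> ne; have [//|u'v] := eqVneq u v; case: (apart u uA u'v ne).
  + by rewrite !r1A //; exact: layout_edge L _ _ _ _ _.
- move=> u; rewrite in_setU1 => /orP[/eqP ->|uA].
    rewrite r1w tt1w /good_slot /=; split.
    + by split; rewrite /=; clear -ab D0 h0 loE hiE b'E lohi; lra.
    + move=> [y x] [Pxy [/= H H0 H1 H2]].
      have {Pxy}[Pxy|[/= ? ? ? ?]] : P1 (x, y) by [].
        have [K K0] : a <= x /\ x <= b.
          by apply: (stripP x y Pxy); clear -ab D0 h0 hE loE hiE b'E H H0 H1 H2; lra.
        by exfalso; clear -D0 H1 K0; lra.
      by split => //=; clear -ab D0 b'E H1 H2; lra.
    (* The orientation decides whether new side 3 or new side 1 is the top of the glued box. *)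
    + case: ord => -[_ _ _ e1 e2].
        exists b', b; split; first by have /has_side_tp := side_new 3%N isT; rewrite /new_side /= -e2.
        by right; clear -D0 b'E; lra.
      exists b, b'; split; first by have /has_side_tp := side_new 1%N isT; rewrite /new_side /= -e2.
      by left; clear -D0 b'E; lra.
  have [->|uv] := eqVneq u v.
    rewrite r1A // tt1v /good_slot /=; split.
    + by split; rewrite /= -?/c -?/d; clear -D0 h0 clo hid hE; lra.
    + move=> z [[Pz|[_ _ _ H]] zb].
        by apply: slotP; split => //; rewrite -regv; exact: tvreg.
      by exfalso; move: zb => [_ _ /= H0 _]; clear -h0 hiE H H0; lra.
    (* The smaller slot of [v] ends on the piece of the removed side above the glued box. *)
    + case: ord => -[k1 k2 k3 e1 e2].
        exists t2, q; split; first exact: (side_new 4%N isT).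
        by left; rewrite /= -e2; case: pq => -[? ?]; lra.
      exists p, t1; split; first exact: (side_new 0%N isT).
      by right; rewrite /= -e2; case: pq => -[? ?]; lra.
  have := layout_slot L uA; rewrite r1A // tt1A //.
  have [h1 h2 h3] := priv u uA uv.
  have out z : box b b' lo hi z -> region (r u) (t u) z -> False.
    by move=> zB zu; rewrite -[False]/(set0 z) -h3; split => //; exact: Breg.
  have [xu _ _] := layout_rect L uA.
  have [D'0 su] : 0 < margin (t u) /\ slo (t u) < shi (t u).
    by have := layout_slot L uA; rewrite /good_slot; case: ifP => _ -[[]].
  rewrite /good_slot; case: ifP => uu; apply: right_slot_transfer.
  + move=> z [[//|zB] zr]; case: (out _ zB); rewrite /region uu.
    by move: zr => [? ? ? ?]; split.
  + move=> p' q' pq' /has_side_tp; rewrite map_tpK => /side_old[] /=.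
      by move=> /has_side_tp /= h4; exists p', q'.
    by move=> [[e1 _] [e2 _]]; exfalso; rewrite e1 e2 in pq'; clear -pq' su; lra.
  + move=> z [[//|zB] zr]; case: (out _ zB); rewrite /region uu.
    by move: zr => [? ? ? ?]; split.
  + move=> p' q' pq' /side_old[|[[ub e1] [_ e2]]]; first by exists p', q'.
    (* If the slot of [u] ends on the removed side too, both regions contain points of that line, so
       their heights are disjoint and the slot of [u] fits on one remaining piece. *)
    have far y : slo (t u) <= y -> y <= shi (t u) -> lo0 <= y -> y <= hi0 -> False.
      move=> y1 y2 y3 y4; rewrite -[False]/(set0 (b, y)) -h3 regv /region uu; split.
        by split => //=; clear -ab D0; lra.
      by split => //=; rewrite -ub; clear -D'0 xu; lra.
    have sep : shi (t u) < lo0 \/ hi0 < slo (t u).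
      have [k1|k1] := lerP lo0 (shi (t u)); last by left.
      have [k2|k2] := lerP (slo (t u)) hi0; last by right.
      have [k3|k3] := lerP lo0 (slo (t u)); exfalso.
        by apply: (far (slo (t u))) => //; exact: ltW.
      by apply: (far lo0) => //; exact: ltW.
    subst p' q'; rewrite ub.
    have s0 := side_new 0%N isT; have s4 := side_new 4%N isT.
    case: ord => -[k1 k2 k3 k4 k5]; case: sep => k6.
    * by exists p, t1; split => //; clear -pq' su k1 k2 k3 k4 k5 k6 loE hiE hE h0; lra.
    * by exists t2, q; split => //; clear -pq' su k1 k2 k3 k4 k5 k6 loE hiE hE h0; lra.
    * by exists t2, q; split => //; clear -pq' su k1 k2 k3 k4 k5 k6 loE hiE hE h0; lra.
    * by exists p, t1; split => //; clear -pq' su k1 k2 k3 k4 k5 k6 loE hiE hE h0; lra.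

- move=> u u'; rewrite !in_setU1 => /orP[/eqP ->|uA] /orP[/eqP ->|u'A] uu'.
  + by rewrite eqxx in uu'.
  + rewrite r1w tt1w; have [->|u'v] := eqVneq u' v; first by rewrite r1A // tt1v.
    have [h1 h2 h3] := priv u' u'A u'v; rewrite r1A // tt1A //.
    by split; [exact: subsetI_eq0 twreg _ h1|exact: subsetI_eq0 twreg _ h3].
  + rewrite r1w tt1w; have [->|u'v] := eqVneq u v.
      by rewrite r1A // tt1v; split => //; rewrite setIC.
    have [h1 h2 h3] := priv u uA u'v; rewrite r1A // tt1A //.
    by split; rewrite setIC; [exact: subsetI_eq0 rwreg _ h3|exact: subsetI_eq0 twreg _ h3].
  + have [h1 h2] := layout_private L uA u'A uu'; split.
      by apply: subsetI_eq0 h1; [exact: reg1|rewrite r1A].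
    by apply: subsetI_eq0 h2; exact: reg1.
Qed.

End Growth.

(** * Connected vertex sets of a tree and their extension by a leaf *)

Section Trees.
Variables (V : finType) (e : rel V).
Implicit Types (A : {set V}).

Definition path_connected A : Prop := forall u v, u \in A -> v \in A ->
  exists p, [/\ path e u p, last u p = v & all (mem A) p].

Lemma path_leaves A u p : path e u p -> u \in A -> last u p \notin A ->
  exists v w, [/\ v \in A, w \notin A & e v w].
Proof.
elim: p u => [|x p IH] u /=; first by move=> _ ->.
move=> /andP[ux xp] uA; have [xA|xA] := boolP (x \in A); first exact: IH.
by exists u, x.
Qed.

Hypothesis he : tree e.

(** A repetition-free path inside [A] between two distinct neighbours of [w] would close up through
    [w] to a cycle with at least three vertices. *)
Lemma tree_neighbour_unique A u v w : path_connected A -> u \in A -> v \in A ->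
  w \notin A -> e v w -> e u w -> u = v.
Proof.
have [[esym eirr] _ _ ecyc] := he.
move=> cA uA vA wA vw uw; apply/eqP/negPn/negP => uv.
have [p0 [p0e p0v p0A]] := cA _ _ uA vA.
case: (shortenP p0e) p0v => p pe pu pp0 pv.
have := ecyc [:: w, u & p]; case: p pe pu pp0 pv => [|x p] pe pu pp0 pv.
  by rewrite /= in pv; rewrite pv eqxx in uv.
have pA y : y \in u :: x :: p -> y \in A.
  by rewrite in_cons => /orP[/eqP -> //|/pp0 /(allP p0A)].
suff cyc : ucycle e [:: w, u, x & p] by move=> /(_ cyc).
rewrite /ucycle; apply/andP; split.
  rewrite (cycle_path w) /= in pe *.
  rewrite -[X in e X w]/(last u (x :: p)) pv vw esym uw /=.
  by rewrite /= in pe.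
rewrite cons_uniq pu andbT; apply: contra wA; exact: pA.
Qed.

Lemma path_connectedU1 A v w : path_connected A -> v \in A -> e v w ->
  path_connected (w |: A).
Proof.
have [[esym eirr] _ _ ecyc] := he.
move=> cA vA vw.
have sub p : all (mem A) p -> all (mem (w |: A)) p.
  by apply: sub_all => x; rewrite !inE => ->; rewrite orbT.
have wsub : w \in w |: A by rewrite in_setU1 eqxx.
move=> x y; rewrite !in_setU1 => /orP[/eqP ->|xA] /orP[/eqP ->|yA].
- by exists [::].
- have [p [pe pl pA]] := cA _ _ vA yA; exists (v :: p); split => //=.
    by rewrite esym vw.
  by rewrite sub // in_setU1 vA orbT.
- have [p [pe pl pA]] := cA _ _ xA vA; exists (rcons p w); split.
  + by rewrite rcons_path pe pl.
  + by rewrite last_rcons.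
  + by rewrite all_rcons sub // andbT.
- by have [p [pe pl pA]] := cA _ _ xA yA; exists p; split => //; exact: sub.
Qed.

(** A path from [A] to a missing vertex has an edge that leaves [A]; its outer end is the new
    leaf. *)
Lemma tree_leaf A : path_connected A -> (0 < #|A|)%N -> (#|A| < #|V|)%N ->
  exists v w, [/\ v \in A, w \notin A, forall u, u \in A -> e u w = (u == v) &
    path_connected (w |: A)].
Proof.
have [_ _ econ _] := he.
move=> cA /card_gt0P[a aA] AV.
have [x xA] : exists x, x \notin A.
  apply/existsP; apply: contraTT AV; rewrite negb_exists -leqNgt => /forallP h.
  by apply: subset_leq_card; apply/fintype.subsetP => y _; have := h y; rewrite negbK.
have /connectP[p pe px] := econ a x.
have [|v [w [vA wA vw]]] := path_leaves pe aA; first by rewrite -px.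
exists v, w; split => //; last exact: path_connectedU1 cA vA vw.
move=> u uA; apply/idP/eqP => [uw|-> //].
exact: tree_neighbour_unique cA uA vA wA vw uw.
Qed.

End Trees.

(** * Layouts of whole trees, and their scales *)

Section TreeLayout.
Variable R : realType.
Notation plane := (R * R)%type.
Variables (V : finType) (e : rel V).

Lemma layout_step (A : {set V}) s (P : set plane) r t v w :
  symmetric e -> layout e A s P r t -> v \in A -> w \notin A ->
  (forall u, u \in A -> e u w = (u == v)) ->
  exists s' P' r' t', @layout R V e (w |: A) s' P' r' t'.
Proof.
move=> esym L vA wA ew; have [up|up] := boolP (upward (t v)); last first.
  exact: layout_step_right L vA wA ew up.
by apply: layout_step_right (layout_tp L) vA wA ew _ => //=; rewrite up.
Qed.

Lemma layout1 (v : V) : exists s P r t, @layout R V e [set v] s P r t.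
Proof.
exists (corners 0 1 0 1), (box 0 1 0 1), (fun=> Rect 0 1 0 1),
  (fun=> Slot false (1 / 3) (2 / 3) 1).
have lt01 : 0 < 1 :> R by exact: ltr01.
split.
- exact: box_polygon.
- apply: axis_parallel_lizard => // -[|[|[|[|//]]]] _; apply/allowed_direction2P;
    by rewrite /vertex /=; split; [move=> []; lra|tauto].
- by move=> u _; split.
- by move=> a b c d _ _ sub; exists v; rewrite ?set11.
- by move=> x y /set1P -> /set1P ->; rewrite eqxx.
- move=> u _; rewrite /good_slot /=; split; first by split => /=; lra.
    by move=> z [].
  exists 0, 1; split; last by left; lra.
  by exists 1%N.
- by move=> x y /set1P -> /set1P ->; rewrite eqxx.
Qed.

Lemma tree_layout : tree e ->
  exists s P r t, @layout R V e [set: V]%SET s P r t.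
Proof.
move=> he; have [[esym _] V0 _ _] := he.
suff grow n : (0 < n <= #|V|)%N -> exists A : {set V}, [/\ #|A| = n,
    path_connected e A & exists s P r t, @layout R V e A s P r t].
  have [|A [AV _ LA]] := grow #|V|; first by rewrite V0 leqnn.
  suff <- : A = [set: V]%SET by [].
  by apply/eqP; rewrite eqEcard finset.subsetT cardsT AV leqnn.
elim: n => // -[|n] IH /andP[_ nV].
  have [v _] : exists v : V, true by case/card_gt0P: V0 => v; exists v.
  exists [set v]%SET; rewrite cards1; split => //; last exact: layout1.
  by move=> x y /set1P -> /set1P ->; exists [::].
have [|A [An cA [s [P [r [t L]]]]]] := IH; first by exact: ltnW.
have [||v [w [vA wA ew cA']]] := tree_leaf he cA; rewrite ?An //.
exists (w |: A); split => //; first by rewrite cardsU1 wA An.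
exact: layout_step L vA wA ew.
Qed.

Lemma layout_MSP s (P : set plane) r t :
  @layout R V e [set: V]%SET s P r t -> MSP_graph R 2 e.
Proof.
move=> L; have inT v : v \in [set: V]%SET by rewrite finset.in_setT.
exists P.
  by exists s; [exact: layout_polygon L|move=> i _; exact: layout_axis L i].
(* A rectangle contains a point of its own slot, which no other rectangle contains. *)
have inj u v : rbox (r u) `<=` rbox (r v) -> u = v.
  move=> uv; apply/eqP/negPn/negP => nuv.
  have [h _] := layout_private L (inT u) (inT v) nuv.
  have [xu yu _] := layout_rect L (inT u).
  suff [z [zu zr]] : exists z, rbox (r u) z /\ region (r u) (t u) z.
    by rewrite -[False]/(set0 z) -h; split => //; exact: uv.
  have := layout_slot L (inT u); rewrite /good_slot /region.
  case: ifP => _ [[/= D0 ? ? ?] _ _].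
    by exists (slo (t u), yl (r u)); split; split; rewrite /= in xu yu *; lra.
  by exists (xl (r u), slo (t u)); split; split; rewrite /= in xu yu *; lra.
have lizv v : convex_lizard 2 (rbox (r v)).
  by have [? ? _] := layout_rect L (inT v); exact: box_convex_lizard.
have rP v : rbox (r v) `<=` P by have [] := layout_rect L (inT v).
have max T : convex_lizard 2 T -> T `<=` P -> exists v, T `<=` rbox (r v).
  move=> /convex_lizard_box[a [b [c [d [ab cd ->]]]]] TP.
  by have [v _ Tv] := layout_max L ab cd TP; exists v.
exists (fun v => rbox (r v)); last first.
  by move=> u v uv; rewrite /rbox !interior_box; exact: layout_edge L _ _ (inT u) (inT v) uv.
split.
- move=> v _; split => // T cT vT TP.
  have [u Tu] := max _ cT TP.
  have uv := inj _ _ (subset_trans vT Tu); subst u.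
  by apply/seteqP; split.
- by move=> u v _ _ uv; apply: inj; rewrite uv.
- move=> S [cS SP Smax]; have [v Sv] := max _ cS SP.
  by exists v => //; exact: Smax.
Qed.

End TreeLayout.

Theorem theorem3p2 (R : realType) (V : finType) (e : rel V) (he : tree e) :
  MSP_graph R 2 e.
Proof. by have [s [P [r [t L]]]] := tree_layout R he; exact: layout_MSP L. Qed.
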